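(* Let $\Omega \subseteq \mathbb{C}$ be an unbounded open set and $F \subseteq \mathbb{N}_0$ be a non-empty set. Then the set $S$ of functions $f \in \mathcal{A}_{F}(\Omega)$ such that all derivatives $f^{(l)}$, $l \in \mathbb{N}_0$, are unbounded on $\Omega$, is dense and $G_\delta$ in $\mathcal{A}_{F}(\Omega)$ (with respect to its natural topology).
   Context: $\mathbb{N}_0=\{0,1,2,\dots\}$, and $f^{(0)}=f$. For an open set $\Omega\subseteq\mathbb{C}$, $H(\Omega)$ is the set of holomorphic functions on $\Omega$, and $\mathcal{A}(\Omega)$ is the set of those $f\in H(\Omega)$ possessing a continuous extension on $\overline{\Omega}$, the closure being taken in $\mathbb{C}$; the extension is denoted by the same symbol. For non-empty $F\subseteq\mathbb{N}_0$, $\mathcal{A}_F(\Omega)=\{f\in H(\Omega): f^{(l)}\in\mathcal{A}(\Omega) \text{ for all } l\in F\}$. Let $\Omega_i$, $i\in I$ ($I$ finite or $I=\mathbb{N}$), be the connected components of $\Omega$ and fix a point $z_i\in\Omega_i$ for each $i\in I$. The natural topology of $\mathcal{A}_F(\Omega)$ is the one induced by the seminorms $\sup_{z\in\overline{\Omega},\,|z|\leqslant n}|f^{(l)}(z)|$, $l\in F$, $n\in\mathbb{N}$, and $|f^{(l)}(z_i)|$, $0\leqslant l<\min F$, $i\in I$. *)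

(* Defs.v *)
From HB Require Import structures.
From mathcomp Require Import all_boot all_order all_algebra.
From mathcomp Require Import complex.
From mathcomp Require Import all_classical all_reals all_analysis borel_hierarchy.

Set Implicit Arguments.
Unset Strict Implicit.
Unset Printing Implicit Defensive.

Import Order.TTheory GRing.Theory Num.Theory.
Import numFieldNormedType.Exports.

Local Open Scope ring_scope.
Local Open Scope classical_set_scope.

(* [R[i]] seen as an abstract numerical field, so that it inherits the topology
   and the normed module structure of MathComp-Analysis; in particular
   [derivable f z 1] and [derive1n l f] are complex differentiability and complex
   derivatives. *)
Definition Cplx (R : realType) : numClosedFieldType := R[i]%C.

(* The norm of [Cplx R] takes values in [Cplx R]; this is the same modulus as a
   real number. *)
Definition modulus (R : realType) (z : Cplx R) : R := complex.Re `|z|.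

Section function_spaces.
Context {R : realType}.
Local Notation C := (Cplx R).
Implicit Types (Omega : set C) (F : set nat) (f g : C -> C).

Definition components Omega : set (set C) :=
  [set connected_component Omega w | w in Omega].

(* Functions on Omega are represented by total functions, of which only the
   values on Omega are considered. *)
Definition holomorphic Omega f := forall w, Omega w -> derivable f w 1.

Definition is_extension Omega f g :=
  {within closure Omega, continuous g} /\ {in Omega, g =1 f}.

Definition is_A Omega f :=
  holomorphic Omega f /\ exists g, is_extension Omega f g.

Definition is_A_F Omega F f :=
  holomorphic Omega f /\ forall l, F l -> is_A Omega (derive1n l f).

(* The continuous extension of [f] to [closure Omega]: when it exists its values
   there are uniquely determined. *)
Definition extension Omega f : C -> C := xget f (is_extension Omega f).

(* Supremum over the closure of Omega, not over Omega itself; it is 0 when no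
   point of the closure has modulus at most n. *)
Definition sup_seminorm Omega (l n : nat) f : R :=
  sup [set modulus (extension Omega (derive1n l f) w) |
    w in closure Omega `&` [set w | modulus w <= n%:R]].

Definition point_seminorm (l : nat) (w : C) f : R := modulus (derive1n l f w).

(* For F nonempty, [forall k, F k -> l < k] says that l < min F. *)
Definition natural_seminorms Omega F (I : set nat) (z : nat -> C) :
    set ((C -> C) -> R) :=
  [set p | (exists l n, [/\ F l, (0 < n)%N & p = sup_seminorm Omega l n]) \/
           (exists l i, [/\ forall k, F k -> (l < k)%N, I i &
                            p = point_seminorm l (z i)])].

(* Extending by 0 outside of Omega gives exactly one representative for each
   function on Omega. The indices [I] and the base points [z] of the components
   only serve to define the topology. *)
Record A_F Omega F (I : set nat) (z : nat -> C) := MkA_F {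
  A_F_fun :> C -> C;
  A_F_prop : is_A_F Omega F A_F_fun;
  A_F_out : forall w, ~ Omega w -> A_F_fun w = 0 }.

Section natural_topology.
Context (Omega : set C) (F I : set nat) (z : nat -> C).

HB.instance Definition _ := gen_eqMixin (A_F Omega F I z).
HB.instance Definition _ := gen_choiceMixin (A_F Omega F I z).

Definition seminorm_balls : set (set (A_F Omega F I z)) :=
  [set B | exists p (f : A_F Omega F I z) (e : R),
     [/\ natural_seminorms Omega F I z p, 0 < e &
         B = [set g : A_F Omega F I z | p (g \- f) < e]]].

HB.instance Definition _ :=
  @isSubBaseTopological.Build (A_F Omega F I z) _ seminorm_balls id.

End natural_topology.
End function_spaces.

(* Main.v *)
Require Import Defs.
From mathcomp Require Import finmap.
From mathcomp Require Import all_boot all_order all_algebra.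
From mathcomp Require Import complex.
From mathcomp Require Import all_classical all_reals all_analysis borel_hierarchy.
From mathcomp Require Import ring lra.

Set Implicit Arguments.
Unset Strict Implicit.
Unset Printing Implicit Defensive.

Import Order.TTheory GRing.Theory Num.Theory.
Import numFieldNormedType.Exports.

Local Open Scope ring_scope.
Local Open Scope classical_set_scope.

(* Density.  One of the four directions t = 1, -1, i, -i satisfies
   sup_Omega Re (t w) = +oo, so every derivative t^l e^(t w) of the entire
   function e^(t w) is unbounded on Omega.  For f in A_F(Omega) and fixed l, the
   l-th derivative of f + c e^(t w) is bounded for at most one real c, since the
   difference of two such functions is a multiple of e^(t w).  Hence all c > 0
   outside a countable set give elements of S, and they tend to f as c -> 0.

   G_delta.  S is the intersection over l, n of the sets of f with
   |f^(l)(w)| > n for some w in Omega, so it suffices that f |-> f^(l)(w) is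
   continuous for all l and w.  For l = m := min F this is one of the seminorms,
   for l > m it follows from Cauchy's estimates, and for l < m from the mean
   value inequality, the set of points of a component where the evaluation is
   continuous being open, closed and containing z_i.

   Complex analysis.  Goursat's triangle lemma gives a primitive F of f on a
   disk.  Differentiating the mean value formula F(w) = int_0^1 F(w + rho g(t)) dt,
   g(t) = e^(2 pi i t), and integrating by parts yields
   f(w) = rho^-1 int_0^1 F(w + rho g) g^-1 and
   f'(w) = rho^-1 int_0^1 f(w + rho g) g^-1 = 2 rho^-2 int_0^1 F(w + rho g) g^-2:
   the second formula gives Cauchy's estimate, the third one shows that f' is
   again holomorphic. *)

(** * Complex differentiability *)

(** The difference quotient is multiplied out, so that the punctured neighbourhood becomes a full
    one. Over a general field [K] the criterion serves both for [R] and for [Cplx R]. *)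
Lemma is_derive_normP {K : numFieldType} (f : K -> K) (w d : K) :
  is_derive w 1 f d <->
  forall e, 0 < e -> \forall v \near w, `|f v - f w - d * (v - w)| <= e * `|v - w|.
Proof.
split=> [[dw <-] e e0|h].
  have : (h^-1 *: (f (h + w) - f w)) @[h --> (0:K)^'] --> 'D_1 f w.
    rewrite [X in X @ _](_ : _ = (fun h => h^-1 *: ((f \o shift w) (h *: 1) - f w))).
      exact: dw.
    by apply/funext => h /=; rewrite [h *: 1]mulr1.
  move=> /(@cvgrPdist_le _ _ _ (0:K)^')/(_ e e0); rewrite near_withinE.
  move=> /(nbhs_ballP (0:K) _)[r /= r0 hr].
  apply/nbhs_ballP; exists r => //= v vw.
  have [->|vw0] := eqVneq v w; first by rewrite !subrr mulr0 subr0 normr0 mulr0.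
  have vw0' : v - w != 0 by rewrite subr_eq0.
  have := hr (v - w); rewrite /= -ball_normE /ball_/= sub0r normrN => /(_ _ vw0').
  move: vw; rewrite -ball_normE /ball_/= distrC => vw /(_ vw).
  rewrite subrK distrC => /(ler_wpM2r (normr_ge0 (v - w))).
  by rewrite -normrM mulrBl /GRing.scale /= mulrAC mulVf// mul1r.
have H : (h^-1 *: ((f \o shift w) (h *: 1) - f w)) @[h --> (0:K)^'] --> d.
  apply/(@cvgrPdist_le _ _ _ (0:K)^') => e e0; rewrite near_withinE.
  have /(nbhs_ballP w _)[r /= r0 hr] := h _ e0.
  apply/(nbhs_ballP (0:K) _); exists r => //= v.
  rewrite -ball_normE /ball_/= sub0r normrN => vr v0; rewrite [v *: 1]mulr1.
  have := hr (v + w); rewrite -ball_normE /ball_/= distrC addrK => /(_ vr) hh.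
  rewrite -(ler_pM2r (_ : 0 < `|v|)) ?normr_gt0//.
  rewrite distrC -normrM mulrBl.
  by rewrite /GRing.scale /= mulrAC mulVf// mul1r.
by split; [apply/cvg_ex; exists d|exact/cvg_lim].
Qed.

Section modulus_theory.
Context {R : realType}.
Local Notation C := (Cplx R).
Implicit Types (x y z w : C) (a b : R).

Definition toC a : C := (a +i* 0)%C.

Definition cRe z : R := complex.Re z.
Definition cIm z : R := complex.Im z.

Lemma cplxP x y : cRe x = cRe y -> cIm x = cIm y -> x = y.
Proof. by case: x y => [a b] [c d] /= -> ->. Qed.

Lemma cReD x y : cRe (x + y) = cRe x + cRe y.
Proof. by case: x y => [a b] [c d]. Qed.
Lemma cImD x y : cIm (x + y) = cIm x + cIm y.
Proof. by case: x y => [a b] [c d]. Qed.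
Lemma cReN x : cRe (- x) = - cRe x.
Proof. by case: x => [a b]. Qed.
Lemma cImN x : cIm (- x) = - cIm x.
Proof. by case: x => [a b]. Qed.
Lemma cReM x y : cRe (x * y) = cRe x * cRe y - cIm x * cIm y.
Proof. by case: x y => [a b] [c d]. Qed.
Lemma cImM x y : cIm (x * y) = cRe x * cIm y + cIm x * cRe y.
Proof. by case: x y => [a b] [c d]. Qed.
Lemma cRe_toC a : cRe (toC a) = a. Proof. by []. Qed.
Lemma cIm_toC a : cIm (toC a) = 0. Proof. by []. Qed.
Lemma cRe0 : cRe 0 = 0. Proof. by []. Qed.
Lemma cIm0 : cIm 0 = 0. Proof. by []. Qed.
Lemma cRe1 : cRe 1 = 1. Proof. by []. Qed.
Lemma cIm1 : cIm 1 = 0. Proof. by []. Qed.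

Definition cplxE := (cReD, cImD, cReN, cImN, cReM, cImM, cRe_toC, cIm_toC,
  cRe0, cIm0, cRe1, cIm1).

Lemma toC0 : toC 0 = 0. Proof. by []. Qed.
Lemma toC1 : toC 1 = 1. Proof. by []. Qed.
Lemma toCD a b : toC (a + b) = toC a + toC b.
Proof. by apply: cplxP; rewrite !cplxE ?addr0. Qed.
Lemma toCN a : toC (- a) = - toC a.
Proof. by apply: cplxP; rewrite !cplxE ?oppr0. Qed.
Lemma toCM a b : toC (a * b) = toC a * toC b.
Proof. by apply: cplxP; rewrite !cplxE; ring. Qed.
Lemma toC_eq0 a : (toC a == 0) = (a == 0).
Proof. by apply/eqP/eqP => [/(congr1 cRe)|->]. Qed.
Lemma toCV a : toC a^-1 = (toC a)^-1.
Proof.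
have [->|a0] := eqVneq a 0; first by rewrite invr0 toC0 invr0.
have a0' : toC a != 0 by rewrite toC_eq0.
by apply: (mulfI a0'); rewrite -toCM !mulfV.
Qed.

Lemma normE z : `|z| = toC (modulus z).
Proof. by rewrite /modulus (normc_def (z : R[i]%C)). Qed.

Lemma modulusE z : modulus z = Num.sqrt (cRe z ^+ 2 + cIm z ^+ 2).
Proof. by rewrite /modulus (normc_def (z : R[i]%C)). Qed.

Lemma toC_le a b : (toC a <= toC b) = (a <= b).
Proof. exact: lecR. Qed.
Lemma toC_lt a b : (toC a < toC b) = (a < b).
Proof. exact: ltcR. Qed.

Lemma gt0_toC (e : C) : 0 < e -> exists2 a, 0 < a & e = toC a.
Proof.
case: e => a b; rewrite ltcE/= => /andP[/eqP -> a0].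
by exists a.
Qed.

Lemma real_toC (e : C) : e \is Num.real -> exists a, e = toC a.
Proof. by move=> /complex_realP[k ->]; exists k. Qed.

Lemma modulus_ge0 z : 0 <= modulus z.
Proof. by rewrite modulusE sqrtr_ge0. Qed.
Lemma modulus0 : modulus (0 : C) = 0.
Proof. by rewrite /modulus normr0. Qed.
Lemma modulus1 : modulus (1 : C) = 1.
Proof. by rewrite /modulus normr1. Qed.
Lemma modulus0_eq0 z : modulus z = 0 -> z = 0.
Proof. by move=> h; apply/eqP; rewrite -normr_eq0 normE h. Qed.
Lemma modulus_gt0 z : z != 0 -> 0 < modulus z.
Proof.
move=> z0; rewrite lt_neqAle modulus_ge0 andbT eq_sym.
by apply/eqP => /modulus0_eq0/eqP; exact/negP.
Qed.
Lemma modulusM x y : modulus (x * y) = modulus x * modulus y.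
Proof. by rewrite {1}/modulus normrM !normE -toCM. Qed.
Lemma modulusN x : modulus (- x) = modulus x.
Proof. by rewrite /modulus normrN. Qed.
Lemma modulusC x y : modulus (x - y) = modulus (y - x).
Proof. by rewrite -modulusN opprB. Qed.
Lemma modulusV x : modulus x^-1 = (modulus x)^-1.
Proof. by rewrite {1}/modulus normfV !normE -toCV. Qed.
Lemma modulusX x n : modulus (x ^+ n) = modulus x ^+ n.
Proof.
by elim: n => [|n IH]; rewrite ?expr0 ?modulus1// !exprS modulusM IH.
Qed.
Lemma modulus_toC a : modulus (toC a) = `|a|.
Proof. by rewrite modulusE !cplxE expr0n addr0 sqrtr_sqr. Qed.

Lemma modulusD x y : modulus (x + y) <= modulus x + modulus y.
Proof. by rewrite -toC_le toCD -!normE; exact: ler_normD. Qed.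
Lemma modulusB x y : modulus (x - y) <= modulus x + modulus y.
Proof. by rewrite -(modulusN y) modulusD. Qed.
Lemma modulus_tri x y z : modulus (x - z) <= modulus (x - y) + modulus (y - z).
Proof. by rewrite -[x - z](subrKA y) modulusD. Qed.
Lemma modulusBl x y : modulus x - modulus y <= modulus (x - y).
Proof. by rewrite lerBlDr -{1}(subrK y x) modulusD. Qed.

Lemma cRe_le z : `|cRe z| <= modulus z.
Proof. by rewrite modulusE -sqrtr_sqr ler_sqrt ?lerDl ?addr_ge0 ?sqr_ge0. Qed.
Lemma cIm_le z : `|cIm z| <= modulus z.
Proof. by rewrite modulusE -sqrtr_sqr ler_sqrt ?lerDr ?addr_ge0 ?sqr_ge0. Qed.

Lemma modulus_le z : modulus z <= `|cRe z| + `|cIm z|.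
Proof.
rewrite modulusE -[leRHS]ger0_norm ?addr_ge0// -sqrtr_sqr.
rewrite ler_sqrt ?sqr_ge0// sqrrD !real_normK ?num_real//.
by rewrite lerD2r lerDl mulrn_wge0// mulr_ge0.
Qed.

Lemma nbhs_modulus w (A : set C) :
  nbhs w A <-> exists2 r : R, 0 < r & forall v, modulus (v - w) < r -> A v.
Proof.
split=> [/nbhs_ballP[e /= e0 h]|[r r0 h]].
  have [r r0 er] := gt0_toC e0; exists r => // v vw; apply: h.
  by rewrite -ball_normE /ball_ /= normE er toC_lt modulusC.
apply/nbhs_ballP; exists (toC r) => /=; first by rewrite -toC0 toC_lt.
by move=> v; rewrite -ball_normE /ball_ /= normE toC_lt modulusC => /h.
Qed.

Lemma cvg_modulusP {T : Type} (F : set_system T) {FF : Filter F} (f : T -> C) l :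
  f @ F --> l <-> forall e : R, 0 < e -> \forall x \near F, modulus (f x - l) < e.
Proof.
split=> [h e e0|h].
  by apply: (h [set v | modulus (v - l) < e]); apply/nbhs_modulus; exists e.
move=> A /nbhs_modulus[e e0 hA]; apply: filterS (h e e0) => x; exact: hA.
Qed.

Lemma toC_continuous : continuous toC.
Proof.
move=> a; apply/cvg_modulusP => e e0; near=> x.
rewrite -toCN -toCD modulus_toC distrC; near: x.
have /cvgrPdist_lt/(_ e e0) : x @[x --> a] --> a by exact: cvg_id.
by [].
Unshelve. all: by end_near. Qed.

Lemma cRe_continuous : continuous cRe.
Proof.
move=> w; apply/(@cvgrPdist_lt _ _ _ (nbhs w)) => e e0; near=> v.
rewrite -cReN -cReD; apply: le_lt_trans (cRe_le _) _; rewrite modulusC; near: v.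
by apply/nbhs_modulus; exists e.
Unshelve. all: by end_near. Qed.

Lemma cIm_continuous : continuous cIm.
Proof.
move=> w; apply/(@cvgrPdist_lt _ _ _ (nbhs w)) => e e0; near=> v.
rewrite -cImN -cImD; apply: le_lt_trans (cIm_le _) _; rewrite modulusC; near: v.
by apply/nbhs_modulus; exists e.
Unshelve. all: by end_near. Qed.

Lemma is_deriveP (f : C -> C) w d : is_derive w 1 f d <->
  forall e : R, 0 < e -> exists2 r : R, 0 < r & forall v, modulus (v - w) < r ->
     modulus (f v - f w - d * (v - w)) <= e * modulus (v - w).
Proof.
split=> [/is_derive_normP h e e0|h].
  have := h (toC e); rewrite -toC0 toC_lt => /(_ e0)/nbhs_modulus[r r0 hr].
  by exists r => // v /hr; rewrite !normE -toCM toC_le.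
apply/is_derive_normP => e /gt0_toC[a a0 ->]; apply/nbhs_modulus.
by have [r r0 hr] := h a a0; exists r => // v /hr; rewrite !normE -toCM toC_le.
Qed.

Lemma is_derive_continuous (f : C -> C) w d : is_derive w 1 f d ->
  {for w, continuous f}.
Proof.
by move=> [dw _]; apply: differentiable_continuous; exact/derivable1_diffP.
Qed.

Lemma is_derive_compC (f g : C -> C) w d d' :
  is_derive (g w) 1 f d -> is_derive w 1 g d' -> is_derive w 1 (f \o g) (d * d').
Proof.
move=> /is_deriveP df /[dup] /is_derive_continuous cg /is_deriveP dg.
apply/is_deriveP => e e0.
have k0 : 0 < modulus d + modulus d' + 2 by rewrite ltr_wpDl// addr_ge0 ?modulus_ge0.
(* The two remainders add up to at most e1 (|d| + |d'| + 1) |v - w|; here e1 <= 1 is used to bound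
   |g v - g w| by (|d'| + 1) |v - w|. *)
pose e1 := Num.min 1 (e / (modulus d + modulus d' + 2)).
have e10 : 0 < e1 by rewrite lt_min ltr01 divr_gt0.
have [r r0 hf] := df e1 e10.
have [s s0 hg] := dg e1 e10.
have /cvg_modulusP/(_ _ r0)/nbhs_modulus[t t0 ht] : g v @[v --> w] --> g w by [].
exists (Num.min s t); first by rewrite lt_min s0.
move=> v; rewrite lt_min => /andP[/hg vs /ht /hf vt] /=.
have e11 : e1 <= 1 by rewrite ge_min lexx.
have e1e : e1 * (modulus d + modulus d' + 2) <= e.
  by rewrite -ler_pdivlMr// ge_min lexx orbT.
have hgv : modulus (g v - g w) <= (modulus d' + 1) * modulus (v - w).
  rewrite -[g v - g w](subrK (d' * (v - w))); apply: le_trans (modulusD _ _) _.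
  by rewrite modulusM mulrDl addrC lerD2l (le_trans vs)// ler_wpM2r ?modulus_ge0.
rewrite (_ : f (g v) - f (g w) - d * d' * (v - w) = (f (g v) - f (g w) - d * (g v - g w)) +
   d * (g v - g w - d' * (v - w))); last by ring.
apply: le_trans (modulusD _ _) _; rewrite modulusM.
apply: le_trans (lerD vt (ler_wpM2l (modulus_ge0 _) vs)) _.
apply: le_trans (lerD (ler_wpM2l (ltW e10) hgv) (lexx _)) _.
rewrite (_ : _ + _ = (e1 * (modulus d + modulus d' + 1)) * modulus (v - w)); last by ring.
rewrite ler_wpM2r ?modulus_ge0// (le_trans _ e1e)// ler_wpM2l ?(ltW e10)//.
by rewrite lerD2l ler1n.
Qed.

Lemma is_derive_affine (a b w : C) : is_derive w 1 (fun z => a + z * b) b.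
Proof.
apply/is_deriveP => e e0; exists 1 => // v _.
by rewrite (_ : _ - _ - _ = 0) ?modulus0 ?mulr_ge0 ?modulus_ge0 ?(ltW e0)//; ring.
Qed.

Lemma is_derive_real (f : C -> C) (t : R) d : is_derive (toC t) 1 f d ->
  is_derive t 1 (cRe \o f \o toC) (cRe d) /\ is_derive t 1 (cIm \o f \o toC) (cIm d).
Proof.
move=> /is_deriveP h; split; apply/is_derive_normP => e e0; have [r r0 hr] := h e e0.
- apply/(nbhs_ballP t); exists r => //= u; rewrite -ball_normE /ball_/= distrC => ur.
  have := hr (toC u); rewrite -toCN -toCD modulus_toC => /(_ ur).
  by apply: le_trans; apply: le_trans (cRe_le _); rewrite !cplxE mulr0 subr0.
- apply/(nbhs_ballP t); exists r => //= u; rewrite -ball_normE /ball_/= distrC => ur.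
  have := hr (toC u); rewrite -toCN -toCD modulus_toC => /(_ ur).
  by apply: le_trans; apply: le_trans (cIm_le _); rewrite !cplxE mulr0 add0r.
Qed.

(* The factor 2 comes from treating the real and imaginary parts separately. *)
Lemma mean_value (f f' : C -> C) (a b : C) (M : R) :
  (forall t : R, 0 <= t <= 1 ->
    is_derive (a + toC t * (b - a)) 1 f (f' (a + toC t * (b - a)))) ->
  (forall t : R, 0 <= t <= 1 -> modulus (f' (a + toC t * (b - a))) <= M) ->
  modulus (f b - f a) <= 2 * M * modulus (b - a).
Proof.
move=> df bf.
pose g z := f (a + z * (b - a)).
pose g' z := f' (a + z * (b - a)) * (b - a).
have dg (t : R) : 0 <= t <= 1 -> is_derive (toC t) 1 g (g' (toC t)).
  move=> t01; exact: (@is_derive_compC f (fun z => a + z * (b - a)) (toC t) _ _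
    (df t t01) (is_derive_affine a (b - a) (toC t))).
have mvt (p : C -> R) : (forall t : R, 0 <= t <= 1 ->
      is_derive t 1 (p \o g \o toC) (p (g' (toC t)))) ->
    (forall z, `|p z| <= modulus z) -> `|p (g 1) - p (g 0)| <= M * modulus (b - a).
  move=> dp ple.
  have [//|t||c] := @MVT R (p \o g \o toC) (fun t => p (g' (toC t))) 0 1.
  - by rewrite in_itv/= => /andP[t0 t1]; apply: dp; rewrite !ltW.
  - apply: derivable_within_continuous => t; rewrite in_itv/= => t01.
    by have [] := dp t t01.
  - rewrite in_itv/= => /andP[c0 c1]; rewrite /= toC0 toC1 subr0 mulr1 => ->.
    apply: le_trans (ple _) _; rewrite modulusM ler_wpM2r ?modulus_ge0//.
    by apply: bf; rewrite !ltW.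
have h1 := mvt cRe (fun t t01 => (is_derive_real (dg t t01)).1) cRe_le.
have h2 := mvt cIm (fun t t01 => (is_derive_real (dg t t01)).2) cIm_le.
rewrite (_ : f b = g 1); last by rewrite /g mul1r addrC subrK.
rewrite (_ : f a = g 0); last by rewrite /g mul0r addr0.
apply: le_trans (modulus_le _) _; rewrite !cplxE.
by rewrite -mulrA mulr_natl mulr2n lerD.
Qed.

End modulus_theory.

(** * Integrals of complex-valued functions on [0, 1] *)

Section complex_integral.
Context {R : realType}.
Local Notation C := (Cplx R).
Local Notation mu := (@lebesgue_measure R).
Implicit Types (g h G H : R -> C).

Definition cint g : C :=
  ((\int[mu]_(x in `[0, 1]) cRe (g x))%R +i* (\int[mu]_(x in `[0, 1]) cIm (g x))%R)%C.

(** Continuity is two-sided at 0 and 1 as well, and so are the derivatives in [derives01]: the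
    integrands below are defined beyond [0, 1]. *)
Definition cont01 {T : topologicalType} (g : R -> T) :=
  forall t : R, 0 <= t <= 1 -> {for t, continuous g}.

Definition derives01 (G g : R -> C) := forall t : R, 0 <= t <= 1 ->
  is_derive t 1 (cRe \o G) (cRe (g t)) /\ is_derive t 1 (cIm \o G) (cIm (g t)).

(** A two-sided derivative at 0 and 1 requires an integrand that is continuous across the end
    points. Hence r is prolonged by constants, by composing it with the projection [cl] onto [0, 1],
    and integrated from -1 inside [-1, 2]. *)
Lemma real_primitive (r : R -> R) : cont01 r ->
  exists G : R -> R, forall t : R, 0 <= t <= 1 -> is_derive t 1 G (r t).
Proof.
move=> cr.
pose cl (x : R) : R := Num.max 0 (Num.min 1 x).
have cl01 x : 0 <= cl x <= 1 by rewrite /cl le_max lexx /= ge_max ler01 ge_min lexx.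
have cl_id (x : R) : 0 <= x <= 1 -> cl x = x.
  by move=> /andP[x0 x1]; rewrite /cl (min_idPr _)// (max_idPr _).
have ccl : continuous cl.
  move=> x; apply: continuous_max; first exact: cst_continuous.
  by apply: continuous_min; [exact: cst_continuous|exact: cvg_id].
have crc : continuous (r \o cl).
  by move=> x; apply: continuous_comp; [exact: ccl|exact: cr].
have int12 : mu.-integrable `[-1, 2] (EFin \o (r \o cl)).
  apply: continuous_compact_integrable; first exact: segment_compact.
  exact: continuous_subspaceT.
exists (fun x => (\int[mu]_(t in `[-1, x]) (r \o cl) t)%R) => t t01.
have t2 : t < 2 by case/andP: t01 => _ /le_lt_trans; apply; rewrite ltr1n.
have t1 : -1 < t by case/andP: t01 => t0 _; rewrite (lt_le_trans _ t0)// ltrN10.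
have [d] := continuous_FTC1_closed t2 int12 t1 (crc t).
by rewrite derive1E => dE; split => //; rewrite dE /= cl_id.
Qed.

Lemma real_FTC2 (G r : R -> R) : cont01 r ->
  (forall t : R, 0 <= t <= 1 -> is_derive t 1 G (r t)) ->
  (\int[mu]_(x in `[0, 1]) r x)%R = G 1 - G 0.
Proof.
move=> cr dG; rewrite /Rintegral (@continuous_FTC2 _ r G 0 1)//.
- by apply: continuous_in_subspaceT => x; rewrite inE/= in_itv/=; exact: cr.
- have cG (t : R) : 0 <= t <= 1 -> {for t, continuous G}.
    move=> /dG[dt _].
    by apply: differentiable_continuous; exact/derivable1_diffP.
  split.
  + move=> x; rewrite in_itv/= => /andP[x0 x1].
    by have [] : is_derive x 1 G (r x) by apply: dG; rewrite !ltW.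
  + by apply: cvg_at_right_filter; apply: cG; rewrite lexx ler01.
  + by apply: cvg_at_left_filter; apply: cG; rewrite lexx ler01.
- move=> x; rewrite in_itv/= => /andP[x0 x1]; rewrite derive1E.
  by have [] : is_derive x 1 G (r x) by apply: dG; rewrite !ltW.
Qed.

Lemma cont01_Re g : cont01 g -> cont01 (cRe \o g).
Proof.
by move=> cg t t01; apply: continuous_comp; [exact: cg|exact: cRe_continuous].
Qed.

Lemma cont01_Im g : cont01 g -> cont01 (cIm \o g).
Proof.
by move=> cg t t01; apply: continuous_comp; [exact: cg|exact: cIm_continuous].
Qed.

Lemma cint_FTC G g : cont01 g -> derives01 G g -> cint g = G 1 - G 0.
Proof.
move=> cg dG; apply: cplxP; rewrite !cplxE.
- by apply: (@real_FTC2 (cRe \o G) (cRe \o g)) => [|t /dG[]//]; exact: cont01_Re.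
- by apply: (@real_FTC2 (cIm \o G) (cIm \o g)) => [|t /dG[]//]; exact: cont01_Im.
Qed.

(** With primitives at hand, linearity of [cint] and the bound [cint_le] reduce to rules for
    derivatives, without any integrability argument. *)
Lemma primitive01 g : cont01 g -> exists G, derives01 G g.
Proof.
move=> cg; have [G1 h1] := real_primitive (cont01_Re cg).
have [G2 h2] := real_primitive (cont01_Im cg).
by exists (fun t => (G1 t +i* G2 t)%C) => t t01; split; [exact: h1|exact: h2].
Qed.

Lemma derives01D G H g h : derives01 G g -> derives01 H h ->
  derives01 (fun t => G t + H t) (fun t => g t + h t).
Proof.
move=> dG dH t t01; have [a b] := dG t t01; have [c d] := dH t t01.
split; rewrite cplxE.
- rewrite [X in is_derive _ _ X _](_ : _ = (cRe \o G) + (cRe \o H)); first exact: is_deriveD.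
  by apply/funext => x /=; rewrite !cplxE.
- rewrite [X in is_derive _ _ X _](_ : _ = (cIm \o G) + (cIm \o H)); first exact: is_deriveD.
  by apply/funext => x /=; rewrite !cplxE.
Qed.

Lemma derives01Z c G g : derives01 G g ->
  derives01 (fun t => c * G t) (fun t => c * g t).
Proof.
move=> dG t t01; have [a b] := dG t t01; split; rewrite cplxE.
- rewrite [X in is_derive _ _ X _](_ : _ = (cRe c *: (cRe \o G)) - (cIm c *: (cIm \o G))).
    by apply: is_deriveB; exact: is_deriveZ.
  by apply/funext => x /=; rewrite !cplxE.
- rewrite [X in is_derive _ _ X _](_ : _ = (cRe c *: (cIm \o G)) + (cIm c *: (cRe \o G))).
    by apply: is_deriveD; exact: is_deriveZ.
  by apply/funext => x /=; rewrite !cplxE.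
Qed.

Lemma derives01_le G g M : derives01 G g ->
  (forall t : R, 0 <= t <= 1 -> modulus (g t) <= M) -> modulus (G 1 - G 0) <= 2 * M.
Proof.
move=> dG gM.
have mvt (p : C -> R) : (forall t : R, 0 <= t <= 1 -> is_derive t 1 (p \o G) (p (g t))) ->
    (forall z, `|p z| <= modulus z) -> `|p (G 1) - p (G 0)| <= M.
  move=> dp ple.
  have [//|t||c] := @MVT R (p \o G) (fun t => p (g t)) 0 1.
  - by rewrite in_itv/= => /andP[t0 t1]; apply: dp; rewrite !ltW.
  - apply: derivable_within_continuous => t; rewrite in_itv/= => t01.
    by have [] := dp t t01.
  - rewrite in_itv/= => /andP[c0 c1]; rewrite /= subr0 mulr1 => ->.
    by apply: le_trans (ple _) _; apply: gM; rewrite !ltW.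
have h1 := mvt cRe (fun t t01 => (dG t t01).1) cRe_le.
have h2 := mvt cIm (fun t t01 => (dG t t01).2) cIm_le.
apply: le_trans (modulus_le _) _; rewrite !cplxE.
by rewrite mulr_natl mulr2n lerD.
Qed.

Lemma cont01D g h : cont01 g -> cont01 h -> cont01 (fun t => g t + h t).
Proof. by move=> cg ch t t01; apply: continuousD; [exact: cg|exact: ch]. Qed.

Lemma cont01M g h : cont01 g -> cont01 h -> cont01 (fun t => g t * h t).
Proof. by move=> cg ch t t01; apply: continuousM; [exact: cg|exact: ch]. Qed.

Lemma cont01_cst (c : C) : cont01 (fun=> c).
Proof. by move=> t _; exact: cst_continuous. Qed.

Lemma cont01Z c g : cont01 g -> cont01 (fun t => c * g t).
Proof. by move=> cg; exact: (cont01M (@cont01_cst c) cg). Qed.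

Lemma cont01_opp g : cont01 g -> cont01 (fun t => - g t).
Proof. by move=> cg t t01; apply: continuousN; exact: cg. Qed.

Lemma cintD g h : cont01 g -> cont01 h ->
  cint (fun t => g t + h t) = cint g + cint h.
Proof.
move=> cg ch; have [G dG] := primitive01 cg; have [H dH] := primitive01 ch.
rewrite (cint_FTC cg dG) (cint_FTC ch dH).
rewrite (cint_FTC (cont01D cg ch) (derives01D dG dH)).
by rewrite opprD addrACA.
Qed.

Lemma cintZ c g : cont01 g -> cint (fun t => c * g t) = c * cint g.
Proof.
move=> cg; have [G dG] := primitive01 cg.
rewrite (cint_FTC cg dG) (cint_FTC (cont01Z cg) (derives01Z c dG)).
by rewrite mulrBr.
Qed.

Lemma cintB g h : cont01 g -> cont01 h ->
  cint (fun t => g t - h t) = cint g - cint h.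
Proof.
move=> cg ch; rewrite -[- cint h]mulN1r -(cintZ (-1) ch) -(cintD cg (cont01Z (c := -1) ch)).
by congr cint; apply/funext => t; rewrite mulN1r.
Qed.

Lemma cint_le g M : cont01 g -> (forall t : R, 0 <= t <= 1 -> modulus (g t) <= M) ->
  modulus (cint g) <= 2 * M.
Proof.
move=> cg gM; have [G dG] := primitive01 cg.
by rewrite (cint_FTC cg dG); exact: derives01_le dG gM.
Qed.

Lemma eq_cint g h : (forall t : R, 0 <= t <= 1 -> g t = h t) -> cint g = cint h.
Proof.
by move=> gh; rewrite /cint; congr Complex; apply: eq_Rintegral => t;
  rewrite inE/= in_itv/= => /gh ->.
Qed.

Lemma affine01 (a b t : R) : 0 <= a <= 1 -> 0 <= a + b <= 1 -> 0 <= t <= 1 ->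
  0 <= a + b * t <= 1.
Proof.
case/andP => a0 a1 /andP[ab0 ab1] /andP[t0 t1].
rewrite (_ : a + b * t = (1 - t) * a + t * (a + b)); last by ring.
apply/andP; split; first by rewrite addr_ge0// mulr_ge0// subr_ge0.
rewrite (@le_trans _ _ ((1 - t) * 1 + t * 1))//; last by rewrite !mulr1 subrK.
by rewrite lerD// ler_wpM2l// subr_ge0.
Qed.

Lemma derives01_comp_affine G g (a b : R) : derives01 G g ->
  0 <= a <= 1 -> 0 <= a + b <= 1 ->
  derives01 (fun t => G (a + b * t)) (fun t => toC b * g (a + b * t)).
Proof.
move=> dG a01 ab01 t t01.
have abt := affine01 a01 ab01 t01.
have dab : is_derive t 1 (fun t => a + b * t) b.
  apply/is_derive_normP => e e0; near=> v.
  by rewrite (_ : _ - _ - _ = 0) ?normr0 ?mulr_ge0 ?(ltW e0)//; ring.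
have [d1 d2] := dG _ abt; split.
- rewrite !cplxE mul0r subr0 mulrC.
  exact: (@is_derive1_comp _ (cRe \o G) (fun t => a + b * t)).
- rewrite !cplxE mul0r addr0 mulrC.
  exact: (@is_derive1_comp _ (cIm \o G) (fun t => a + b * t)).
Unshelve. all: by end_near. Qed.

Lemma cont01_comp_affine {T : topologicalType} (g : R -> T) (a b : R) : cont01 g ->
  0 <= a <= 1 -> 0 <= a + b <= 1 -> cont01 (fun t => g (a + b * t)).
Proof.
move=> cg a01 ab01 t t01.
have abt := affine01 a01 ab01 t01.
apply: (@continuous_comp _ _ _ (fun t => a + b * t) g); last exact: cg.
by apply: continuousD; [exact: cst_continuous|apply: continuousM;
  [exact: cst_continuous|exact: cvg_id]].
Qed.

(** One function G serves all subintervals, b being allowed to be negative. Splitting and reversing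
    a segment thus become identities between differences of values of G. *)
Lemma cint_affine g : cont01 g -> exists G : R -> C, forall a b : R,
  0 <= a <= 1 -> 0 <= a + b <= 1 ->
  toC b * cint (fun t => g (a + b * t)) = G (a + b) - G a.
Proof.
move=> cg; have [G dG] := primitive01 cg; exists G => a b a01 ab01.
have cga := cont01_comp_affine cg a01 ab01.
rewrite -cintZ//.
rewrite (cint_FTC (cont01Z cga) (derives01_comp_affine dG a01 ab01)).
by rewrite mulr1 mulr0 addr0.
Qed.

End complex_integral.

(** * Goursat's lemma *)

Section goursat.
Context {R : realType}.
Local Notation C := (Cplx R).
Implicit Types (f F H L : C -> C) (a b u v w z : C).

(** A closed disk is convex: the point is the convex combination of [a] and [a + v] with weights 1 -
    t and t. *)
Lemma convex_modulus a v w (r t : R) : 0 <= t <= 1 ->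
  modulus (a - w) <= r -> modulus (a + v - w) <= r -> modulus (a + toC t * v - w) <= r.
Proof.
move=> /andP[t0 t1] ha hb.
rewrite (_ : _ - w = toC (1 - t) * (a - w) + toC t * (a + v - w)); last first.
  by rewrite toCD toCN toC1; ring.
apply: le_trans (modulusD _ _) _; rewrite !modulusM !modulus_toC.
rewrite !ger0_norm ?subr_ge0//.
rewrite (@le_trans _ _ ((1 - t) * r + t * r))//; last by rewrite -mulrDl subrK mul1r.
by rewrite lerD// ler_wpM2l// subr_ge0.
Qed.

Lemma convex_modulus_lt a v w (r t : R) : 0 <= t <= 1 ->
  modulus (a - w) < r -> modulus (a + v - w) < r -> modulus (a + toC t * v - w) < r.
Proof.
move=> t01 ha hb.
apply: (@le_lt_trans _ _ (Num.max (modulus (a - w)) (modulus (a + v - w)))).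
  by apply: convex_modulus; rewrite // le_max lexx ?orbT.
by rewrite gt_max ha.
Qed.

Definition cont_seg f a v := cont01 (fun t => f (a + toC t * v)).

(* The segment from [a] to [a + v]. *)
Definition segint f a v := v * cint (fun t => f (a + toC t * v)).

Lemma cont_segP f a v :
  (forall t : R, 0 <= t <= 1 -> {for (a + toC t * v), continuous f}) -> cont_seg f a v.
Proof.
move=> cf t t01; apply: (@continuous_comp _ _ _ (fun t => a + toC t * v) f); last exact: cf.
apply: (@continuousD _ _ _ (fun=> a)); first exact: cst_continuous.
by apply: (@continuousM _ _ toC (fun=> v)); [exact: toC_continuous|exact: cst_continuous].
Qed.

Lemma segint_FTC F f a v : cont_seg f a v ->
  (forall t : R, 0 <= t <= 1 -> is_derive (a + toC t * v) 1 F (f (a + toC t * v))) ->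
  segint f a v = F (a + v) - F a.
Proof.
move=> cf dF; rewrite /segint -cintZ//.
rewrite (@cint_FTC _ (fun t => F (a + toC t * v))).
- by rewrite toC0 toC1 mul0r mul1r addr0.
- exact: cont01Z cf.
- move=> t t01; rewrite mulrC.
  exact: (is_derive_real (@is_derive_compC _ F (fun z => a + z * v) (toC t) _ _
    (dF t t01) (is_derive_affine a v (toC t)))).
Qed.

(** The integral of L is known exactly through its primitive F, so only the integral of f - L has to
    be estimated; the 2 is that of [cint_le]. *)
Lemma segint_approx F f L a v (e : R) : cont_seg f a v -> cont_seg L a v ->
  (forall t : R, 0 <= t <= 1 -> is_derive (a + toC t * v) 1 F (L (a + toC t * v))) ->
  (forall t : R, 0 <= t <= 1 -> modulus (f (a + toC t * v) - L (a + toC t * v)) <= e) ->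
  modulus (segint f a v - (F (a + v) - F a)) <= 2 * e * modulus v.
Proof.
move=> cf cL dF fL; rewrite -(segint_FTC cL dF) /segint -mulrBr -(cintB cf cL).
have hb := cint_le (cont01D cf (cont01_opp cL)) fL.
by rewrite modulusM mulrC; exact: ler_wpM2r (modulus_ge0 _) _ _ hb.
Qed.

Let h : C := toC 2^-1.

Let addKBC a u v : a + u + (v - u) = a + v. Proof. by ring. Qed.

Lemma halfD z : h * z + h * z = z.
Proof.
rewrite -mulrDl -toCD (_ : 2^-1 + 2^-1 = 1); last by lra.
by rewrite toC1 mul1r.
Qed.

Lemma segint_split f a v : cont_seg f a v ->
  segint f a v = segint f a (h * v) + segint f (a + h * v) (h * v).
Proof.
move=> cf; have [G hG] := cint_affine cf.
have h0 : 0 <= 2^-1 :> R by rewrite invr_ge0.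
have h1 : 2^-1 <= 1 :> R by rewrite invf_le1 ?ler1n.
have e1 := hG 0 1; rewrite !add0r !lexx ler01 in e1.
have e2 := hG 0 2^-1; rewrite !add0r lexx ler01 h0 h1 in e2.
have e3 := hG 2^-1 2^-1; rewrite (_ : 2^-1 + 2^-1 = 1) in e3; last by lra.
rewrite lexx ler01 h0 h1 in e3.
have -> : segint f a v = v * (G 1 - G 0).
  rewrite -e1// toC1 mul1r /segint; congr (_ * _).
  by apply: eq_cint => t _; rewrite add0r mul1r.
have -> : segint f a (h * v) = v * (G 2^-1 - G 0).
  rewrite -e2// -/h [h * v]mulrC /segint -mulrA; congr (_ * (_ * _)).
  apply: eq_cint => t _; rewrite add0r toCM; congr (f _).
  by rewrite [v * _]mulrC mulrA [toC t * _]mulrC.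
have -> : segint f (a + h * v) (h * v) = v * (G 1 - G 2^-1).
  rewrite -e3// -/h /segint [h * v]mulrC -[LHS]mulrA; congr (_ * (_ * _)).
  apply: eq_cint => t _; rewrite toCD toCM; congr (f _); rewrite -/h; ring.
by ring.
Qed.

Lemma segint_rev f a v : cont_seg f a v -> segint f (a + v) (- v) = - segint f a v.
Proof.
move=> cf; have [G hG] := cint_affine cf.
have e1 := hG 0 1; rewrite !add0r !lexx ler01 in e1.
have e2 := hG 1 (-1); rewrite subrr !lexx ler01 in e2.
have -> : segint f a v = v * (G 1 - G 0).
  rewrite -e1// toC1 mul1r /segint; congr (_ * _).
  by apply: eq_cint => t _; rewrite add0r mul1r.
have -> : segint f (a + v) (- v) = v * (G 0 - G 1).
  rewrite -e2// toCN toC1 /segint mulrA mulrN1; congr (_ * _).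
  apply: eq_cint => t _; congr (f _); rewrite toCD toCM toCN toC1; ring.
by ring.
Qed.

(* The triangle with vertices [a], [a + u], [a + v]. *)
Definition triint f a u v :=
  segint f a u + segint f (a + u) (v - u) + segint f (a + v) (- v).

Section triangle.
Variables (f : C -> C) (w : C) (r : R).
Hypothesis cf : forall z, modulus (z - w) < r -> {for z, continuous f}.

Lemma cont_seg_ball a v : modulus (a - w) < r -> modulus (a + v - w) < r -> cont_seg f a v.
Proof. by move=> ha hb; apply: cont_segP => t t01; apply: cf; exact: convex_modulus_lt. Qed.

(** Subdivision by the midpoints of the sides. The fourth triangle is the medial one: its corner is
    the midpoint of the side opposite to [a], and its edge vectors are reversed, so that each inner
    side is run through once in each direction. *)
Lemma triint_split a u v : modulus (a - w) < r -> modulus (a + u - w) < r ->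
  modulus (a + v - w) < r ->
  triint f a u v = triint f a (h * u) (h * v) + triint f (a + h * u) (h * u) (h * v) +
   triint f (a + h * v) (h * u) (h * v) +
   triint f (a + h * u + h * v) (- (h * u)) (- (h * v)).
Proof.
move=> ha hu hv.
have h01 : 0 <= (2^-1 : R) <= 1 by apply/andP; split; lra.
have hau : modulus (a + h * u - w) < r by exact: convex_modulus_lt.
have hav : modulus (a + h * v - w) < r by exact: convex_modulus_lt.
have huv : modulus (a + u + h * (v - u) - w) < r.
  by apply: convex_modulus_lt => //; rewrite addKBC.
have E : a + u + h * (v - u) = a + h * u + h * v.
  by rewrite -{1}(halfD u); ring.
rewrite E in huv.
(* The three outer sides are cut at their midpoints. *)
have s1 : segint f a u = segint f a (h * u) + segint f (a + h * u) (h * u).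
  by apply: segint_split; exact: cont_seg_ball.
have s2 : segint f (a + u) (v - u) =
    segint f (a + u) (h * v - h * u) + segint f (a + h * u + h * v) (h * v - h * u).
  rewrite -E -mulrBr; apply: segint_split; apply: cont_seg_ball => //.
  by rewrite addKBC.
have s3 : segint f (a + v) (- v) =
    segint f (a + v) (- (h * v)) + segint f (a + h * v) (- (h * v)).
  rewrite segint_split; last by apply: cont_seg_ball => //; rewrite addrK.
  by rewrite mulrN (_ : a + v - h * v = a + h * v)// -{1}(halfD v); ring.
(* The three inner sides cancel in pairs. *)
have r1 : segint f (a + h * v) (h * u - h * v) = - segint f (a + h * u) (h * v - h * u).
  rewrite -segint_rev; last first.
    by apply: cont_seg_ball => //; rewrite addKBC.
  by rewrite addKBC opprB.
have r2 : segint f (a + h * u + h * v) (- (h * u)) = - segint f (a + h * v) (h * u).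
  rewrite -segint_rev; last by apply: cont_seg_ball => //; rewrite (addrAC a).
  by rewrite (addrAC a).
have r3 : segint f (a + h * u + h * v) (- (h * v)) = - segint f (a + h * u) (h * v).
  by rewrite -segint_rev//; exact: cont_seg_ball.
rewrite /triint s1 s2 s3.
rewrite (_ : a + h * u + h * u = a + u); last by rewrite -addrA halfD.
rewrite (_ : a + h * v + h * v = a + v); last by rewrite -addrA halfD.
rewrite (_ : a + h * v + h * u = a + h * u + h * v); last by rewrite addrAC.
rewrite (_ : a + h * u + h * v + - (h * u) = a + h * v); last by ring.
rewrite (_ : a + h * u + h * v + - (h * v) = a + h * u); last by ring.
rewrite (_ : - (h * v) - - (h * u) = h * u - h * v); last by ring.
rewrite opprK r1 r2 r3.
by ring.
Qed.

(** An affine function has a primitive, so its integral over the closed triangle vanishes and only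
    the error e remains. The perimeter is at most 2 (|u| + |v|), and [segint_approx] contributes
    another factor 2. *)
Lemma triint_approx a u v (z0 al be : C) (e : R) : modulus (a - w) < r ->
  modulus (a + u - w) < r -> modulus (a + v - w) < r ->
  (forall z, modulus (z - a) <= modulus u + modulus v ->
      modulus (f z - (al + be * (z - z0))) <= e) ->
  modulus (triint f a u v) <= 4 * e * (modulus u + modulus v).
Proof.
move=> ha hu hv fL.
pose L z := al + be * (z - z0).
pose F z := al * z + h * be * (z - z0) ^+ 2.
have dL z : is_derive z 1 L be.
  have := is_derive_affine (al - be * z0) be z.
  by congr is_derive; apply/funext => y; rewrite /L; ring.
have dF z : is_derive z 1 F (L z).
  apply/is_deriveP => e0 e00.
  (* The remainder of the quadratic F is exactly be / 2 times (y - z)^2; the + 1 allows for be =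
     0. *)
  exists (e0 / (modulus be + 1)).
    by rewrite divr_gt0// ltr_wpDl ?modulus_ge0.
  move=> y hy.
  rewrite (_ : F y - F z - L z * (y - z) = h * be * (y - z) * (y - z)); last first.
    rewrite /F /L -{3}(halfD be); ring.
  rewrite modulusM ler_wpM2r ?modulus_ge0// !modulusM /h modulus_toC.
  have : modulus (y - z) * (modulus be + 1) <= e0.
    by rewrite -ler_pdivlMr ?ltr_wpDl ?modulus_ge0// ltW.
  apply: le_trans; rewrite mulrC ler_wpM2l ?modulus_ge0//.
  rewrite ger0_norm ?invr_ge0//.
  by have := modulus_ge0 be; lra.
have cL z : {for z, continuous L} by exact: is_derive_continuous (dL z).
have du := modulus_ge0 u; have dv := modulus_ge0 v.
have approx b q : modulus (b - w) < r -> modulus (b + q - w) < r ->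
    modulus (b - a) <= modulus u + modulus v ->
    modulus (b + q - a) <= modulus u + modulus v ->
    modulus (segint f b q - (F (b + q) - F b)) <= 2 * e * modulus q.
  move=> hb hbq ba bqa; apply: (@segint_approx F f L).
  - exact: cont_seg_ball.
  - by apply: cont_segP => t _; exact: cL.
  - by move=> t t01; apply: fL; exact: convex_modulus.
have e0 : 0 <= e.
  by apply: le_trans (fL a _); rewrite ?modulus_ge0// subrr modulus0 addr_ge0.
have auv : a + u + (v - u) = a + v by ring.
have a1 : modulus (segint f a u - (F (a + u) - F a)) <= 2 * e * modulus u.
  by apply: approx; rewrite // ?subrr ?modulus0 ?addr_ge0// addrC addKr lerDl.
have a2 : modulus (segint f (a + u) (v - u) - (F (a + v) - F (a + u))) <=
    2 * e * (modulus u + modulus v).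
  rewrite -auv; apply: le_trans (approx _ _ _ _ _ _) _; rewrite ?auv//.
  - by rewrite addrC addKr lerDl.
  - by rewrite addrC addKr lerDr.
  - by rewrite ler_wpM2l ?mulr_ge0// (addrC (modulus u)) modulusB.
have a3 : modulus (segint f (a + v) (- v) - (F a - F (a + v))) <= 2 * e * modulus v.
  have := approx (a + v) (- v); rewrite addrK modulusN subrr modulus0; apply => //.
  - by rewrite addrC addKr lerDr.
  - exact: addr_ge0.
rewrite (_ : triint f a u v = (segint f a u - (F (a + u) - F a)) +
  (segint f (a + u) (v - u) - (F (a + v) - F (a + u))) +
  (segint f (a + v) (- v) - (F a - F (a + v)))); last by rewrite /triint; ring.
apply: le_trans (modulusD _ _) _.
apply: le_trans (lerD (modulusD _ _) (lexx _)) _.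
apply: le_trans (lerD (lerD a1 a2) a3) _.
by rewrite le_eqVlt; apply/orP; left; apply/eqP; ring.
Qed.

End triangle.

End goursat.

(** * Goursat's lemma and primitives on a disk *)

Section primitive.
Context {R : realType}.
Local Notation C := (Cplx R).
Implicit Types (f F : C -> C) (a b u v w z : C).

(** The intervals [x n - D / 2^n, x n + D / 2^n] are nested, and the supremum of their left ends
    lies in all of them. *)
Lemma geometric_cauchy_real (x : nat -> R) (D : R) : 0 <= D ->
  (forall n, `|x n.+1 - x n| <= D / 2 ^+ n.+1) ->
  exists l, forall n, `|l - x n| <= D / 2 ^+ n.
Proof.
move=> D0 hx.
have p2 n : 0 < 2 ^+ n :> R by rewrite exprn_gt0.
have half n : D / 2 ^+ n = D / 2 ^+ n.+1 + D / 2 ^+ n.+1.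
  by rewrite exprS; field; rewrite expf_neq0.
have lo n : x n - D / 2 ^+ n <= x n.+1 - D / 2 ^+ n.+1.
  by have := hx n; rewrite ler_norml => /andP[+ _]; have := half n; lra.
have hi n : x n.+1 + D / 2 ^+ n.+1 <= x n + D / 2 ^+ n.
  by have := hx n; rewrite ler_norml => /andP[_]; have := half n; lra.
have lo' n k : x n - D / 2 ^+ n <= x (n + k)%N - D / 2 ^+ (n + k)%N.
  by elim: k => [|k IH]; rewrite ?addn0// addnS (le_trans IH).
have hi' n k : x (n + k)%N + D / 2 ^+ (n + k)%N <= x n + D / 2 ^+ n.
  by elim: k => [|k IH]; rewrite ?addn0// addnS (le_trans (hi _)).
have lh n m : x m - D / 2 ^+ m <= x n + D / 2 ^+ n.
  apply: le_trans (lo' m n) _; apply: le_trans (hi' n m); rewrite (addnC n m).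
  have : 0 <= D / 2 ^+ (m + n)%N by rewrite divr_ge0// ltW.
  by lra.
pose A := range (fun n => x n - D / 2 ^+ n).
have A0 : A !=set0 by exists (x 0%N - D / 2 ^+ 0), 0%N.
have Aub : has_ubound A by exists (x 0%N + D / 2 ^+ 0) => _ [m _ <-].
exists (sup A) => n.
have s1 : x n - D / 2 ^+ n <= sup A by apply: ub_le_sup => //; exists n.
have s2 : sup A <= x n + D / 2 ^+ n by apply: ge_sup => // _ [m _ <-].
by rewrite ler_norml; apply/andP; split; lra.
Qed.

Lemma geometric_cauchy (x : nat -> C) (D : R) : 0 <= D ->
  (forall n, modulus (x n.+1 - x n) <= D / 2 ^+ n.+1) ->
  exists l, forall n, modulus (l - x n) <= 2 * D / 2 ^+ n.
Proof.
move=> D0 hx.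
have [|l1 h1] := @geometric_cauchy_real (fun n => cRe (x n)) D D0.
  by move=> n; apply: le_trans (hx n); rewrite -cReN -cReD cRe_le.
have [|l2 h2] := @geometric_cauchy_real (fun n => cIm (x n)) D D0.
  by move=> n; apply: le_trans (hx n); rewrite -cImN -cImD cIm_le.
exists (l1 +i* l2)%C => n; apply: le_trans (modulus_le _) _; rewrite !cplxE.
by rewrite -mulrA mulr_natl mulr2n; apply: lerD; [exact: h1|exact: h2].
Qed.

Lemma modulusD4 a b u v :
  modulus (a + b + u + v) <= modulus a + modulus b + modulus u + modulus v.
Proof.
apply: le_trans (modulusD _ _) _; rewrite lerD2r.
apply: le_trans (modulusD _ _) _; rewrite lerD2r.
exact: modulusD.
Qed.

Section holomorphic_ball.
Variables (f : C -> C) (w : C) (r : R).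
Hypothesis df : forall z, modulus (z - w) < r -> derivable f z 1.

Lemma holomorphic_ball_continuous z : modulus (z - w) < r -> {for z, continuous f}.
Proof.
by move=> /df dz; apply: differentiable_continuous; exact/derivable1_diffP.
Qed.

Let cf := holomorphic_ball_continuous.
Let h : C := toC 2^-1.

Let modulus_h z : modulus (h * z) = modulus z / 2.
Proof. by rewrite modulusM modulus_toC ger0_norm ?invr_ge0// mulrC. Qed.

(** A triple consists of a corner and the two edge vectors that start from it. *)
Let triangle := (C * C * C)%type.
Let T (x : triangle) := triint f x.1.1 x.1.2 x.2.
Let inside (rho : R) (x : triangle) := [/\ modulus (x.1.1 - w) <= rho,
  modulus (x.1.1 + x.1.2 - w) <= rho & modulus (x.1.1 + x.2 - w) <= rho].

(** One of the four pieces of [triint_split] carries at least a quarter of the integral, and each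
    has edges of half the length. The vertices are kept in a closed disk of radius [rho] smaller
    than r, so that a limit of such triangles stays in the open disk. *)
Lemma bisect rho (x : triangle) : rho < r -> inside rho x -> exists y : triangle,
  [/\ inside rho y, modulus y.1.2 = modulus x.1.2 / 2, modulus y.2 = modulus x.2 / 2,
   modulus (y.1.1 - x.1.1) <= (modulus x.1.2 + modulus x.2) / 2 &
   modulus (T x) / 4 <= modulus (T y)].
Proof.
case: x => [[a u] v] rhor [/= ha hu hv].
have split4 : T (a, u, v) = T (a, h * u, h * v) + T (a + h * u, h * u, h * v) +
   T (a + h * v, h * u, h * v) + T (a + h * u + h * v, - (h * u), - (h * v)).
  by apply: (triint_split cf); rewrite /= (le_lt_trans _ rhor).
have h01 : 0 <= (2^-1 : R) <= 1 by apply/andP; split; lra.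
have hau : modulus (a + h * u - w) <= rho by exact: convex_modulus.
have hav : modulus (a + h * v - w) <= rho by exact: convex_modulus.
have hh z : h * z + h * z = z.
  rewrite -mulrDl -toCD (_ : 2^-1 + 2^-1 = 1); last by lra.
  by rewrite toC1 mul1r.
have huv : modulus (a + h * u + h * v - w) <= rho.
  rewrite (_ : a + h * u + h * v = a + u + h * (v - u)); last first.
    by rewrite -{2}(hh u); ring.
  apply: convex_modulus => //.
  by rewrite (_ : a + u + (v - u) = a + v)//; ring.
have [mu0 mv0] : 0 <= modulus u /\ 0 <= modulus v by split; exact: modulus_ge0.
(* The first piece that reaches a quarter is taken; if three pieces fail, the triangle inequality
   forces the fourth to succeed. *)
have [q1|q1] := leP (modulus (T (a, u, v)) / 4) (modulus (T (a, h * u, h * v))).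
  exists (a, h * u, h * v); split => //=.
  by rewrite subrr modulus0; lra.
have [q2|q2] := leP (modulus (T (a, u, v)) / 4) (modulus (T (a + h * u, h * u, h * v))).
  exists (a + h * u, h * u, h * v); split => //=.
    by split => //=; rewrite -(addrA a) hh.
  by rewrite addrC addKr modulus_h; lra.
have [q3|q3] := leP (modulus (T (a, u, v)) / 4) (modulus (T (a + h * v, h * u, h * v))).
  exists (a + h * v, h * u, h * v); split => //=.
    by split => //=; [rewrite (addrAC a)|rewrite -(addrA a) hh].
  by rewrite addrC addKr modulus_h; lra.
exists (a + h * u + h * v, - (h * u), - (h * v)); split => /=.
- split => //=; last by rewrite addrK.
  by rewrite (addrAC a) addrK.
- by rewrite modulusN modulus_h.
- by rewrite modulusN modulus_h.
- rewrite (_ : a + h * u + h * v - a = h * u + h * v); last by ring.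
  apply: le_trans (modulusD _ _) _.
  by rewrite !modulus_h; lra.
have := modulusD4 (T (a, h * u, h * v)) (T (a + h * u, h * u, h * v))
  (T (a + h * v, h * u, h * v)) (T (a + h * u + h * v, - (h * u), - (h * v))).
rewrite -split4; move: q1 q2 q3.
move: (modulus (T (a, u, v))) (modulus (T (a, h * u, h * v)))
  (modulus (T (a + h * u, h * u, h * v))) (modulus (T (a + h * v, h * u, h * v)))
  (modulus (T (a + h * u + h * v, - (h * u), - (h * v)))) => m m1 m2 m3 m4.
by lra.
Qed.

(** Repeated bisection gives triangles shrinking to a point z0. Differentiability at z0 bounds the
    n-th integral by an arbitrarily small multiple of 4^-n, whereas by construction it is at least
    4^-n times the original one. *)
Lemma goursat a u v : modulus (a - w) < r -> modulus (a + u - w) < r ->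
  modulus (a + v - w) < r -> triint f a u v = 0.
Proof.
move=> ha hu hv.
pose rho := Num.max (modulus (a - w)) (Num.max (modulus (a + u - w)) (modulus (a + v - w))).
have rhor : rho < r by rewrite !gt_max ha hu hv.
(* The condition [inside rho x] is made a premise in order that the successor be defined for all
   triples. *)
have /boolp.choice[next nextP] : forall x : triangle, exists y : triangle, inside rho x ->
  [/\ inside rho y, modulus y.1.2 = modulus x.1.2 / 2, modulus y.2 = modulus x.2 / 2,
   modulus (y.1.1 - x.1.1) <= (modulus x.1.2 + modulus x.2) / 2 &
   modulus (T x) / 4 <= modulus (T y)].
  move=> x; have [xin|xout] := pselect (inside rho x); last by exists x => /xout.
  by have [y yP] := bisect rhor xin; exists y.
pose X n := iter n next (a, u, v).
pose D := modulus u + modulus v.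
have D0 : 0 <= D by rewrite addr_ge0 ?modulus_ge0.
have Xin n : inside rho (X n).
  elim: n => [|n /nextP[]//].
  by split; rewrite /= !le_max lexx ?orbT.
have Xu n : modulus (X n).1.2 + modulus (X n).2 = D / 2 ^+ n.
  elim: n => [|n IH]; first by rewrite expr0 divr1.
  have [_ e1 e2 _ _] := nextP _ (Xin n).
  rewrite [X n.+1]/X iterS -/(X n) e1 e2 -mulrDl IH exprSr invfM.
  by rewrite mulrA.
have XT n : modulus (triint f a u v) / 4 ^+ n <= modulus (T (X n)).
  elim: n => [|n IH]; first by rewrite expr0 divr1.
  have [_ _ _ _ e] := nextP _ (Xin n).
  rewrite [X n.+1]/X iterS -/(X n) exprSr invfM mulrA.
  by apply: le_trans e; rewrite ler_wpM2r// invr_ge0.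
have Xa n : modulus ((X n.+1).1.1 - (X n).1.1) <= D / 2 ^+ n.+1.
  have [_ _ _ e _] := nextP _ (Xin n).
  by rewrite exprSr invfM mulrA -Xu.
have [z0 z0P] := geometric_cauchy D0 Xa.
have p2 n : 0 < 2 ^+ n :> R by rewrite exprn_gt0.
(* At stage n the relevant points are within 3 D / 2^n of z0: the corner is within 2 D / 2^n of it,
   and the triangle has size at most D / 2^n. *)
have small (e : R) : 0 < e -> exists n, 3 * D / 2 ^+ n < e.
  move=> e0; have [n hn] : exists n, 3 * D / e < 2 ^+ n.
    have [n hn] : exists n : nat, 3 * D / e < n%:R.
      exists (Num.bound (3 * D / e)).
      by apply: archi_boundP; rewrite divr_ge0 ?mulr_ge0// ltW.
    exists n; apply: lt_trans hn _.
    by rewrite -natrX ltr_nat ltn_expl.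
  by exists n; rewrite ltr_pdivrMr// [e * _]mulrC -ltr_pdivrMr.
have z0r : modulus (z0 - w) < r.
  have [n hn] : exists n, 3 * D / 2 ^+ n < r - rho by apply: small; rewrite subr_gt0.
  have [xa _ _] := Xin n; have := z0P n.
  have := modulus_tri z0 (X n).1.1 w.
  have : 2 * D / 2 ^+ n <= 3 * D / 2 ^+ n.
    by rewrite ler_wpM2r ?invr_ge0 ?(ltW (p2 n))// ler_wpM2r// ler_nat.
  lra.
have [d /is_deriveP dP] : exists d, is_derive z0 1 f d.
  by exists ('D_1 f z0); split => //; exact: df.
apply: modulus0_eq0; apply/eqP; rewrite eq_le modulus_ge0 andbT.
apply/ler_addgt0Pr => e e0; rewrite add0r.
(* The bound at stage n is 4 * 3 * e1 * D^2 / 4^n; the + 1 covers D = 0. *)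
pose e1 := e / (12 * D ^+ 2 + 1).
have q0 : 0 < 12 * D ^+ 2 + 1 by rewrite ltr_wpDl// mulr_ge0// sqr_ge0.
have e10 : 0 < e1 by rewrite divr_gt0.
have [s s0 hs] := dP e1 e10; have [n hn] := small s s0.
have [xa xu xv] := Xin n.
have k0 : 0 <= D / 2 ^+ n by rewrite divr_ge0// ltW.
have := @triint_approx _ f w r cf (X n).1.1 (X n).1.2 (X n).2 z0 (f z0) d
  (e1 * (3 * D / 2 ^+ n)) (le_lt_trans xa rhor) (le_lt_trans xu rhor) (le_lt_trans xv rhor).
rewrite Xu => H.
have {H} : modulus (T (X n)) <= 4 * (e1 * (3 * D / 2 ^+ n)) * (D / 2 ^+ n).
  apply: H => z za.
  have zz0 : modulus (z - z0) <= 3 * D / 2 ^+ n.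
    have := modulus_tri z (X n).1.1 z0; have := z0P n; rewrite (modulusC z0).
    by rewrite -!(mulrA _ D); lra.
  rewrite (_ : _ - _ = f z - f z0 - d * (z - z0)); last by rewrite opprD addrA.
  apply: le_trans (hs _ (le_lt_trans zz0 hn)) _.
  by rewrite ler_wpM2l// ltW.
move=> /(le_trans (XT n)); rewrite ler_pdivrMr ?exprn_gt0//.
move=> /le_trans; apply.
rewrite (_ : 4 ^+ n = 2 ^+ n * 2 ^+ n); last first.
  by rewrite -exprMn; congr (_ ^+ _); ring.
have p2n : 2 ^+ n != 0 :> R by rewrite gt_eqF.
rewrite (_ : 4 * (e1 * (3 * D / 2 ^+ n)) * (D / 2 ^+ n) * (2 ^+ n * 2 ^+ n) =
  e1 * (12 * D ^+ 2)); last by field.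
apply: (@le_trans _ _ (e1 * (12 * D ^+ 2 + 1))).
  by rewrite ler_wpM2l ?(ltW e10)// lerDl.
by rewrite /e1 divfK// gt_eqF.
Qed.

(** The primitive is the integral along the segment from the centre w to z. By Goursat on the
    triangle w, z, y, its increment from z to y is the integral of f over the segment from z to
    y. *)
Lemma holomorphic_primitive :
  exists F, forall z, modulus (z - w) < r -> is_derive z 1 F (f z).
Proof.
exists (fun z => segint f w (z - w)) => z hz.
have hw : modulus (w - w) < r.
  by rewrite subrr modulus0 (le_lt_trans (modulus_ge0 _) hz).
apply/is_deriveP => e e0.
have e20 : 0 < e / 2 by rewrite divr_gt0.
have /cvg_modulusP/(_ _ e20)/nbhs_modulus[s s0 hs] : f y @[y --> z] --> f z by exact: cf.
exists (Num.min s (r - modulus (z - w))) => [|y].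
  by rewrite lt_min s0 subr_gt0.
rewrite lt_min => /andP[ys yr].
have hy : modulus (y - w) < r.
  by have := modulus_tri y z w; move: yr; lra.
have wz (x : C) : w + (x - w) = x by rewrite addrC subrK.
have := @goursat w (z - w) (y - w) hw; rewrite !wz => /(_ hz hy).
rewrite /triint !wz (_ : y - w - (z - w) = y - z); last by ring.
have -> : segint f y (- (y - w)) = - segint f w (y - w).
  rewrite -segint_rev ?wz//.
  by apply: (cont_seg_ball cf) => //; rewrite wz.
move=> /subr0_eq <-; rewrite [X in X - _ - _]addrC addrK.
have -> : e = 2 * (e / 2) by field.
have hzy : z + (y - z) = y by rewrite addrC subrK.
(* On this segment f is compared with the constant f z, within e / 2, because of the factor 2 in
   [segint_approx]. *)
have := @segint_approx _ (fun x => f z * x) f (fun=> f z) z (y - z) (e / 2).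
rewrite -mulrBr hzy; apply.
- by apply: (cont_seg_ball cf) => //; rewrite hzy.
- by apply: cont_segP => t _; exact: cst_continuous.
- move=> t _.
  have := is_derive_affine 0 (f z) (z + toC t * (y - z)).
  by congr is_derive; apply/funext => x; rewrite add0r mulrC.
- move=> t /andP[t0 t1]; apply/ltW/hs.
  rewrite (addrC z) addrK modulusM modulus_toC ger0_norm//.
  by apply: le_lt_trans ys; rewrite ler_piMl ?modulus_ge0.
Qed.

End holomorphic_ball.
End primitive.

(** * Cauchy's formula *)

Section complex_exponential.
Context {R : realType}.
Local Notation C := (Cplx R).
Implicit Types (z w : C).

Definition cexp z : C :=
  ((expR (cRe z) * cos (cIm z)) +i* (expR (cRe z) * sin (cIm z)))%C.

Lemma cexpD z w : cexp (z + w) = cexp z * cexp w.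
Proof.
by apply: cplxP; rewrite [LHS]/= !cplxE [RHS]/= expRD ?cosD ?sinD; ring.
Qed.

Lemma cexp0 : cexp 0 = 1.
Proof. by apply: cplxP; rewrite /= expR0 ?cos0 ?sin0 ?mulr1 ?mulr0. Qed.

Lemma modulus_cexp z : modulus (cexp z) = expR (cRe z).
Proof.
rewrite modulusE /= !exprMn -mulrDr cos2Dsin2 mulr1 sqrtr_sqr.
by rewrite ger0_norm// expR_ge0.
Qed.

Lemma is_derive0P (f : R -> R) (d : R) : is_derive (0:R) 1 f d -> forall e, 0 < e ->
  exists2 r : R, 0 < r & forall v, `|v| < r -> `|f v - f 0 - d * v| <= e * `|v|.
Proof.
move=> /is_derive_normP df e e0; have /(nbhs_ballP (0:R) _)[r /= r0 hr] := df e e0.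
exists r => // v vr; have := hr v; rewrite -ball_normE /ball_/= sub0r normrN.
by rewrite subr0; apply.
Qed.

(** The expansions of exp, cos and sin at 0 are combined in the real and imaginary parts; the
    general point follows from the addition formula. *)
Lemma is_derive_cexp0 : is_derive (0 : C) 1 cexp 1.
Proof.
apply/is_deriveP => e e0.
(* The four error terms [q1] to [q4] contribute 1, 2, 3 and 2 times d |z|, hence the 8. *)
pose d := Num.min 1 (e / 8).
have d0 : 0 < d by rewrite lt_min ltr01 divr_gt0.
have d1 : d <= 1 by rewrite ge_min lexx.
have de : 8 * d <= e by rewrite mulrC -ler_pdivlMr// ge_min lexx orbT.
clearbody d.
have [r r0 hr] := is_derive0P (is_derive_expR (0:R)) d0.
have [s s0 hs] := is_derive0P (is_derive_cos (0:R)) d0.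
have [t t0 ht] := is_derive0P (is_derive_sin (0:R)) d0.
exists (Num.min d (Num.min r (Num.min s t))) => [|z]; first by rewrite !lt_min d0 r0 s0 t0.
rewrite !subr0 cexp0 mul1r !lt_min => /and4P[zd zr zs zt].
have [] := (cRe_le z, cIm_le z); set x := cRe z; set y := cIm z => xz yz.
have := hr x (le_lt_trans xz zr); rewrite expR0 mul1r => {}hr.
have := hs y (le_lt_trans yz zs); rewrite cos0 sin0 oppr0 mul0r subr0 => {}hs.
have := ht y (le_lt_trans yz zt); rewrite cos0 sin0 subr0 mul1r => {}ht.
have xd : `|x| <= d by apply/ltW/(le_lt_trans xz).
have ex1 : `|expR x - 1| <= 2 * d.
  rewrite -[expR x - 1](subrK x); apply: le_trans (ler_normD _ _) _.
  have : d * `|x| <= 1 * `|x| by rewrite ler_wpM2r.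
  by lra.
have ex : `|expR x| <= 3.
  by rewrite -[expR x](subrK 1); apply: le_trans (ler_normD _ _) _; rewrite normr1; lra.
have cos1 : `|cos y| <= 1 by rewrite ler_norml cos_geN1 cos_le1.
have x1 : `|1 + x| <= 2.
  by apply: le_trans (ler_normD _ _) _; rewrite normr1; lra.
have q1 : `|(expR x - 1 - x) * cos y| <= d * `|x|.
  by rewrite normrM -[leRHS]mulr1 ler_pM.
have q2 : `|(1 + x) * (cos y - 1)| <= 2 * (d * `|y|) by rewrite normrM ler_pM.
have q3 : `|expR x * (sin y - y)| <= 3 * (d * `|y|) by rewrite normrM ler_pM.
have q4 : `|(expR x - 1) * y| <= 2 * d * `|y| by rewrite normrM ler_pM.
have dx : d * `|x| <= d * modulus z by rewrite ler_wpM2l// ltW.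
have dy : d * `|y| <= d * modulus z by rewrite ler_wpM2l// ltW.
apply: (@le_trans _ _ (8 * d * modulus z)); last by rewrite ler_wpM2r ?modulus_ge0.
apply: le_trans (modulus_le _) _; rewrite !cplxE [cRe (cexp z)]/= [cIm (cexp z)]/= -/x -/y.
rewrite (_ : expR x * cos y - 1 - x =
  (expR x - 1 - x) * cos y + (1 + x) * (cos y - 1)); last by ring.
rewrite (_ : expR x * sin y - 0 - y = expR x * (sin y - y) + (expR x - 1) * y); last by ring.
apply: le_trans (lerD (ler_normD _ _) (ler_normD _ _)) _.
by lra.
Qed.

Lemma is_derive_cexp z : is_derive z 1 cexp (cexp z).
Proof.
apply/is_deriveP => e e0.
have k0 : 0 < modulus (cexp z) by rewrite modulus_cexp expR_gt0.
have /is_deriveP h := is_derive_cexp0.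
have [r r0 hr] := h _ (divr_gt0 e0 k0).
exists r => // v vr; have := hr (v - z); rewrite !subr0 cexp0 mul1r => /(_ vr) H.
rewrite -{1}(subrK z v) cexpD.
rewrite (_ : cexp (v - z) * cexp z - cexp z - cexp z * (v - z) =
  cexp z * (cexp (v - z) - 1 - (v - z))); last by ring.
rewrite modulusM mulrC -ler_pdivlMr//; apply: le_trans H _.
by rewrite mulrAC.
Qed.

(** These exponentials appear in two roles: with c an integral multiple of 2 pi i they are the
    powers of the parametrization of the circle, and with c = t they are the unbounded perturbations
    in the proof of density. *)
Definition expc (c z : C) := cexp (z * c).

Lemma is_derive_expc c z : is_derive z 1 (expc c) (c * expc c z).
Proof.
have da := is_derive_affine 0 c z.
have := @is_derive_compC _ cexp (fun z => 0 + z * c) z _ _ (is_derive_cexp _) da.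
by rewrite mulrC add0r; congr is_derive; apply/funext => y /=; rewrite add0r.
Qed.

Lemma continuous_expc c z : {for z, continuous (expc c)}.
Proof. exact: is_derive_continuous (is_derive_expc c z). Qed.

Lemma derive1n_expc c n : derive1n n (expc c) = fun z => c ^+ n * expc c z.
Proof.
elim: n => [|n IH]; first by apply/funext => z; rewrite expr0 mul1r.
rewrite derive1nS IH; apply/funext => z; rewrite derive1E.
have [_ ->] : is_derive z 1 (c ^+ n *: expc c) (c ^+ n *: (c * expc c z)).
  by apply: is_deriveZ; exact: is_derive_expc.
by rewrite /GRing.scale/= mulrA -exprSr.
Qed.

Definition twopii : C := (0 +i* (pi *+ 2))%C.

Lemma twopii_neq0 : twopii != 0.
Proof.
apply/eqP => /(congr1 cIm) /=; apply/eqP; rewrite gt_eqF//.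
by rewrite mulrn_wgt0// pi_gt0.
Qed.

Lemma cexp_twopii : cexp twopii = 1.
Proof.
apply: cplxP; rewrite /= expR0 mul1r ?cos2pi ?sin2pi//.
Qed.

End complex_exponential.

(** * Differentiation under the integral sign *)

Section cauchy.
Context {R : realType}.
Local Notation C := (Cplx R).
Implicit Types (f F : C -> C) (p q c : R -> C) (w z : C).

(** The tube lemma: by compactness of [0, 1], a property that holds locally in t, for x near x0,
    holds for all t at once. *)
Lemma near_segment (T : topologicalType) (x0 : T) (P : T -> R -> Prop) :
  (forall t : R, 0 <= t <= 1 -> \forall t' \near t & x \near x0, P x t') ->
  \forall x \near x0, forall t : R, 0 <= t <= 1 -> P x t.
Proof.
move=> h.
have cpt : near_covering (`[0, 1]%classic : set R).
  by apply/compact_near_coveringP; exact: segment_compact.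
have FF : Filter (nbhs x0) by exact: nbhs_filter.
have H : \near x0, `[0, 1]%classic `<=` P x0.
  by apply: (cpt T (nbhs x0) P FF) => t; rewrite /= in_itv/=; exact: h.
by apply: filterS H => x hx t t01; apply: hx; rewrite /= in_itv.
Qed.

Lemma modulus_continuous : continuous (@modulus R).
Proof.
move=> w; apply/(@cvgrPdist_lt _ _ _ (nbhs w)) => e e0; near=> v.
apply: (@le_lt_trans _ _ (modulus (w - v))).
  by rewrite ler_norml lerNl opprB {1}modulusC !modulusBl.
rewrite modulusC; near: v.
by apply/nbhs_modulus; exists e.
Unshelve. all: by end_near. Qed.

Lemma cont01_bounded p : cont01 p ->
  exists2 M : R, 0 <= M & forall t : R, 0 <= t <= 1 -> modulus (p t) <= M.
Proof.
move=> cp.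
have [|c _ cmax] := @EVT_max R (fun t => modulus (p t)) 0 1 ler01.
  apply: continuous_in_subspaceT => x; rewrite inE/= in_itv/= => x01.
  by apply: (@continuous_comp _ _ _ p (@modulus R)); [exact: cp|exact: modulus_continuous].
exists (modulus (p c)) => [|t t01]; first exact: modulus_ge0.
by apply: cmax; rewrite in_itv.
Qed.

(** The linearization error of F at p t + h0 q t is small relative to |h - h0|, uniformly in t:
    locally by the mean value inequality and the continuity of f, then on all of [0, 1] by
    compactness. Taking p or q constant later gives derivatives in the radius and in the centre of a
    circle. *)
Lemma cint_param F f p q c (h0 : C) :
  (forall t : R, 0 <= t <= 1 -> exists2 r : R, 0 < r &
     forall z, modulus (z - (p t + h0 * q t)) < r -> is_derive z 1 F (f z)) ->
  (forall t : R, 0 <= t <= 1 -> {for (p t + h0 * q t), continuous f}) ->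
  cont01 p -> cont01 q -> cont01 c ->
  is_derive h0 1 (fun h => cint (fun t => F (p t + h * q t) * c t))
    (cint (fun t => f (p t + h0 * q t) * (q t * c t))).
Proof.
move=> dF cf cp cq cc.
have [Q Q0 hQ] := cont01_bounded cq.
have [K K0 hK] := cont01_bounded cc.
apply/is_deriveP => e e0.
have K1 : 0 < K + 1 by rewrite ltr_wpDl.
have Q1 : 0 < Q + 1 by rewrite ltr_wpDl.
(* The error e1 of F is multiplied by the weight c, at most K + 1, and by the 2 of [cint_le]. In
   turn, e1 arises from 2 e2 in the mean value inequality and e2 for the change from f P0 to f z1,
   times |q|, at most Q + 1. *)
have [e1 e10 e1E] : exists2 e1 : R, 0 < e1 & 2 * (e1 * (K + 1)) = e.
  exists (e / (2 * (K + 1))); first by rewrite divr_gt0// mulr_gt0.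
  by field; rewrite gt_eqF.
have [e2 e20 e2E] : exists2 e2 : R, 0 < e2 & 3 * e2 * (Q + 1) = e1.
  exists (e1 / (3 * (Q + 1))); first by rewrite divr_gt0// mulr_gt0.
  by field; rewrite gt_eqF.
(* The second [0 <= t <= 1] belongs to the property passed to [near_segment], since parameters close
   to one of [0, 1] may leave it. Continuity of F is carried along because the rules for [cint] ask
   for it. *)
have /nbhs_modulus[s s0 hs] : \forall h \near h0, forall t : R, 0 <= t <= 1 -> 0 <= t <= 1 ->
    {for (p t + h * q t), continuous F} /\
    modulus (F (p t + h * q t) - F (p t + h0 * q t) - (h - h0) * (f (p t + h0 * q t) * q t))
      <= e1 * modulus (h - h0).
  apply: near_segment => t0 t001.
  have [r1 r10 hr1] := dF t0 t001.
  have /cvg_modulusP/(_ _ e20)/nbhs_modulus[r2 r20 hr2] := cf t0 t001.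
  set P0 := p t0 + h0 * q t0 in hr1 hr2.
  pose r := Num.min r1 r2.
  have r0 : 0 < r by rewrite lt_min r10 r20.
  have cpq : (fun x : R * C => p x.1 + x.2 * q x.1) @ nbhs (t0, h0) --> P0.
    apply: (@cvgD _ _ _ _ _ (fun x : R * C => p x.1) (fun x : R * C => x.2 * q x.1)).
      by apply: (@cvg_comp _ _ _ fst p); [exact: cvg_fst|exact: cp].
    apply: cvgM; first exact: cvg_snd.
    by apply: (@cvg_comp _ _ _ fst q); [exact: cvg_fst|exact: cq].
  have cpq0 : (fun x : R * C => p x.1 + h0 * q x.1) @ nbhs (t0, h0) --> P0.
    apply: (@cvgD _ _ _ _ _ (fun x : R * C => p x.1) (fun x : R * C => h0 * q x.1)).
      by apply: (@cvg_comp _ _ _ fst p); [exact: cvg_fst|exact: cp].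
    apply: cvgM; first exact: cvg_cst.
    by apply: (@cvg_comp _ _ _ fst q); [exact: cvg_fst|exact: cq].
  move/cvg_modulusP/(_ _ r0) : cpq => n1.
  move/cvg_modulusP/(_ _ r0) : cpq0 => n2.
  have n12 : \forall x \near (t0, h0), modulus (p x.1 + x.2 * q x.1 - P0) < r /\
      modulus (p x.1 + h0 * q x.1 - P0) < r.
    by apply: filterS2 n1 n2 => x.
  apply: filterS n12 => -[t h] /= [z2r z1r] t01.
  set z1 := p t + h0 * q t in z1r *; set z2 := p t + h * q t in z2r *.
  have z21 : z2 - z1 = (h - h0) * q t by rewrite /z1 /z2; ring.
  have inr1 z : modulus (z - P0) < r -> modulus (z - P0) < r1.
    by rewrite lt_min => /andP[].
  have inr2 z : modulus (z - P0) < r -> modulus (f z - f P0) <= e2.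
    by rewrite lt_min => /andP[_ /hr2/ltW].
  split; first by apply: is_derive_continuous (hr1 _ (inr1 _ z2r)).
  have inseg (x : R) : 0 <= x <= 1 -> modulus (z1 + toC x * (z2 - z1) - P0) < r.
    move=> x01; apply: convex_modulus_lt => //.
    by rewrite (addrC z1) subrK.
  (* After subtraction of the linear function with slope f P0, the derivative is at most e2 on the
     whole segment. *)
  have mv := @mean_value R (fun z => F z - f P0 * z) (fun z => f z - f P0) z1 z2 e2.
  have {mv} : modulus (F z2 - f P0 * z2 - (F z1 - f P0 * z1)) <= 2 * e2 * modulus (z2 - z1).
    apply: mv => x x01; last by apply: inr2; exact: inseg.
    apply: is_deriveB; first by apply: hr1; apply: inr1; exact: inseg.
    have := is_derive_affine 0 (f P0) (z1 + toC x * (z2 - z1)).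
    by congr is_derive; apply/funext => y; rewrite add0r mulrC.
  move=> mv.
  rewrite (_ : _ - _ - _ = (F z2 - f P0 * z2 - (F z1 - f P0 * z1)) -
     (f z1 - f P0) * (z2 - z1)); last by rewrite z21; rewrite /z1 /z2; ring.
  apply: le_trans (modulusB _ _) _.
  have q2 : modulus ((f z1 - f P0) * (z2 - z1)) <= e2 * modulus (z2 - z1).
    by rewrite modulusM ler_wpM2r ?modulus_ge0// inr2.
  apply: le_trans (lerD mv q2) _.
  rewrite z21 modulusM.
  have q3 : modulus (q t) <= Q + 1 by rewrite (le_trans (hQ t t01))// lerDl.
  rewrite (_ : _ + _ = 3 * e2 * modulus (h - h0) * modulus (q t)); last by ring.
  apply: (@le_trans _ _ (3 * e2 * modulus (h - h0) * (Q + 1))).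
    by rewrite ler_wpM2l// mulr_ge0 ?modulus_ge0// mulr_ge0// ltW.
  by rewrite mulrAC e2E.
exists s => // h hhs.
have cFq (x : C) : modulus (x - h0) < s -> cont01 (fun t => F (p t + x * q t)).
  move=> xs t t01; have [cFx _] := hs x xs t t01 t01.
  apply: (@continuous_comp _ _ _ (fun t => p t + x * q t) F); last exact: cFx.
  exact: (cont01D cp (cont01Z (c := x) cq)).
have cfp : cont01 (fun t => f (p t + h0 * q t)).
  move=> t t01; apply: (@continuous_comp _ _ _ (fun t => p t + h0 * q t) f); last exact: cf.
  exact: (cont01D cp (cont01Z (c := h0) cq)).
have h0s : modulus (h0 - h0) < s by rewrite subrr modulus0.
have c1 := cont01M (cFq h hhs) cc.
have c2 := cont01M (cFq h0 h0s) cc.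
have c3 := cont01M cfp (cont01M cq cc).
rewrite -(cintB c1 c2) mulrC -(cintZ (h - h0) c3).
rewrite -(cintB (cont01D c1 (cont01_opp c2)) (cont01Z (c := h - h0) c3)).
have : forall t : R, 0 <= t <= 1 ->
   modulus (F (p t + h * q t) * c t - F (p t + h0 * q t) * c t -
   (h - h0) * (f (p t + h0 * q t) * (q t * c t))) <= e1 * modulus (h - h0) * (K + 1).
  move=> t t01; have [_ H] := hs h hhs t t01 t01.
  rewrite (_ : F (p t + h * q t) * c t - F (p t + h0 * q t) * c t -
    (h - h0) * (f (p t + h0 * q t) * (q t * c t)) = (F (p t + h * q t) - F (p t + h0 * q t) -
    (h - h0) * (f (p t + h0 * q t) * q t)) * c t); last by ring.
  rewrite modulusM ler_pM ?modulus_ge0//.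
  by rewrite (le_trans (hK t t01))// lerDl.
move=> /(cint_le (cont01D (cont01D c1 (cont01_opp c2))
  (cont01_opp (cont01Z (c := h - h0) c3)))).
move=> /le_trans; apply.
by rewrite mulrAC mulrA e1E.
Qed.

End cauchy.

(** * Integrals over circles *)

Section circle.
Context {R : realType}.
Local Notation C := (Cplx R).
Implicit Types (f F : C -> C) (w z s k : C).

Local Notation tau := (@twopii R).
Local Notation gam := (fun t : R => expc tau (toC t)).

Lemma expcM a k z : expc a z * expc k z = expc (a + k) z :> C.
Proof. by rewrite /expc -cexpD mulrDr. Qed.

Lemma expc0 z : expc 0 z = 1 :> C.
Proof. by rewrite /expc mulr0 cexp0. Qed.

Lemma cont01_expc k : cont01 (fun t : R => expc k (toC t)).
Proof.
move=> t _; apply: (@continuous_comp _ _ _ toC (expc k)); first exact: toC_continuous.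
exact: continuous_expc.
Qed.

Lemma modulus_expc k (t : R) : cRe k = 0 -> modulus (expc k (toC t)) = 1.
Proof. by move=> k0; rewrite modulus_cexp !cplxE k0 mulr0 mul0r subr0 expR0. Qed.

Lemma cexp_Ntau : cexp (- tau) = 1 :> C.
Proof. by have := cexpD (- tau) tau; rewrite addNr cexp0 cexp_twopii mulr1. Qed.

Lemma cexp_N2tau : cexp (- tau - tau) = 1 :> C.
Proof. by rewrite cexpD cexp_Ntau mulr1. Qed.

Lemma expc_at1 k : expc k (toC 1) = cexp k.
Proof. by rewrite /expc toC1 mul1r. Qed.

Lemma expc_at0 k : expc k (toC 0) = 1.
Proof. by rewrite /expc toC0 mul0r cexp0. Qed.

Section disk.
Variables (F f : C -> C) (w0 : C) (r : R).
Hypothesis dF : forall z, modulus (z - w0) < r -> is_derive z 1 F (f z).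
Hypothesis cf : forall z, modulus (z - w0) < r -> {for z, continuous f}.

Lemma circle_in w s (t : R) : modulus (w - w0) + modulus s < r ->
  modulus (w + s * gam t - w0) < r.
Proof.
apply: le_lt_trans; rewrite addrAC; apply: le_trans (modulusD _ _) _.
by rewrite lerD2l modulusM modulus_expc ?mulr1.
Qed.

Lemma ball_nbhs z : modulus (z - w0) < r -> exists2 e : R, 0 < e &
  forall v, modulus (v - z) < e -> modulus (v - w0) < r.
Proof.
move=> zr; exists (r - modulus (z - w0)); first by rewrite subr_gt0.
by move=> v; rewrite ltrBrDr; apply: le_lt_trans; exact: modulus_tri.
Qed.

Lemma cont01_circle (g : C -> C) w s :
  (forall z, modulus (z - w0) < r -> {for z, continuous g}) ->
  modulus (w - w0) + modulus s < r -> cont01 (fun t => g (w + s * gam t)).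
Proof.
move=> cg ws t t01.
apply: (@continuous_comp _ _ _ (fun t => w + s * gam t) g); last first.
  by apply: cg; exact: circle_in.
exact: (cont01D (@cont01_cst _ w) (cont01Z (c := s) (@cont01_expc tau)) t01).
Qed.

Lemma primitive_continuous z : modulus (z - w0) < r -> {for z, continuous F}.
Proof. by move=> zr; exact: is_derive_continuous (dF zr). Qed.

(* The function [F (w + s * g) * expc k] takes the same value at both ends of the
   circle, so that its derivative integrates to 0. *)
Lemma circle_parts k w s : cexp k = 1 -> modulus (w - w0) + modulus s < r ->
  tau * s * cint (fun t => f (w + s * gam t) * expc (tau + k) (toC t)) +
  k * cint (fun t => F (w + s * gam t) * expc k (toC t)) = 0.
Proof.
move=> k1 ws.
have c1 := cont01M (cont01_circle cf ws) (@cont01_expc (tau + k)).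
have c2 := cont01M (cont01_circle primitive_continuous ws) (@cont01_expc k).
rewrite -(cintZ _ c1) -(cintZ _ c2) -(cintD (cont01Z (c := tau * s) c1) (cont01Z (c := k) c2)).
rewrite (@cint_FTC _ (fun t => F (w + s * gam t) * expc k (toC t))).
- by rewrite !expc_at1 !expc_at0 cexp_twopii k1 subrr.
- exact: (cont01D (cont01Z (c := tau * s) c1) (cont01Z (c := k) c2)).
move=> t t01.
pose G z := F (w + s * expc tau z).
have dG : is_derive (toC t) 1 G (f (w + s * gam t) * (s * (tau * gam t))).
  apply: (@is_derive_compC _ F (fun z => w + s * expc tau z)).
    by apply: dF; exact: circle_in.
  rewrite -[s * (tau * _)]add0r; apply: (@is_deriveD _ _ _ (fun=> w)).
  by apply: is_deriveZ; exact: is_derive_expc.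
have := is_derive_real (@is_deriveM _ _ G (expc k) (toC t) 1 _ _ dG (is_derive_expc k _)).
have -> : G (toC t) *: (k * expc k (toC t)) +
    expc k (toC t) *: (f (w + s * gam t) * (s * (tau * gam t))) =
  tau * s * (f (w + s * gam t) * expc (tau + k) (toC t)) +
    k * (F (w + s * gam t) * expc k (toC t)).
  by rewrite -expcM /GRing.scale/= /G; ring.
by [].
Qed.

(* The derivative of the mean with respect to the radius, taken complex, is 0. *)
Lemma circle_mean w (rho : R) : 0 < rho -> modulus (w - w0) + rho < r ->
  F w = cint (fun t => F (w + toC rho * gam t)).
Proof.
move=> rho0 wr.
pose m s := cint (fun t => F (w + s * gam t) * 1).
have dm s : modulus s <= rho -> is_derive s 1 m 0.
  move=> srho.
  have ws : modulus (w - w0) + modulus s < r by apply: le_lt_trans wr; rewrite lerD2l.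
  have := @cint_param R F f (fun=> w) gam (fun=> 1) s.
  rewrite (_ : cint _ = 0).
    apply => [t t01|t t01|||].
    - have [e e0 he] := ball_nbhs (circle_in t ws).
      by exists e => // z /he/dF.
    - by apply: cf; exact: circle_in.
    - exact: cont01_cst.
    - exact: cont01_expc.
    - exact: cont01_cst.
  have c1 := cont01M (cont01_circle cf ws) (@cont01_expc tau).
  (* For s = 0 the identity of [circle_parts] is divided by 0; there the integrand is f w times the
     circle parametrization, whose integral over a full turn vanishes. *)
  have [s0|s0] := eqVneq s 0.
    rewrite (@eq_cint _ _ (fun t => f w * gam t)); last first.
      by move=> t _; rewrite s0 mul0r addr0 mulr1.
    rewrite (cintZ _ (@cont01_expc tau)).
    rewrite (@cint_FTC _ (fun t => tau^-1 * gam t)).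
    + by rewrite expc_at1 expc_at0 cexp_twopii subrr mulr0.
    + exact: cont01_expc.
    move=> t _.
    have := is_derive_real (@is_deriveZ _ _ _ (expc tau) tau^-1 (toC t) 1 _
      (is_derive_expc tau _)).
    by rewrite [X in cRe X](mulKf (@twopii_neq0 R)) [X in cIm X](mulKf (@twopii_neq0 R)).
  have := circle_parts cexp0 ws.
  rewrite mul0r !addr0 => /eqP; rewrite mulf_eq0 mulf_eq0.
  rewrite (negbTE s0) (negbTE (@twopii_neq0 R))/= => /eqP <-.
  by apply: eq_cint => t _; rewrite mulr1.
have seg (t : R) : 0 <= t <= 1 -> modulus (0 + toC t * (toC rho - 0)) <= rho.
  move=> /andP[t0 t1]; rewrite add0r subr0 -toCM modulus_toC ger0_norm ?mulr_ge0 ?(ltW rho0)//.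
  by rewrite ler_piMl// ltW.
have := @mean_value R m (fun=> 0) 0 (toC rho) 0.
rewrite mulr0 mul0r => H.
(* With derivative 0 along the segment from 0 to rho, the mean equals its value at radius 0, which
   is F w. *)
have /modulus0_eq0/subr0_eq m0 : modulus (m (toC rho) - m 0) = 0.
  apply/eqP; rewrite eq_le modulus_ge0 andbT; apply: H => t t01.
    by apply: dm; exact: seg.
  by rewrite modulus0.
rewrite -[RHS](_ : m (toC rho) = _); last by apply: eq_cint => t _; rewrite mulr1.
rewrite m0 /m (@eq_cint _ _ (fun=> F w)); last first.
  by move=> t _; rewrite mul0r addr0 mulr1.
rewrite (@cint_FTC _ (fun t => F w * toC t)).
- by rewrite toC0 toC1 mulr1 mulr0 subr0.
- exact: cont01_cst.
move=> t _.
have := is_derive_real (is_derive_affine 0 (F w) (toC t)).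
rewrite (_ : (fun z => 0 + z * F w) = *%R (F w))//.
by apply/funext => y; rewrite add0r mulrC.
Qed.

(** This is [cint_param] with the centre as the parameter: p is the circle around 0 and q = 1. *)
Lemma circle_deriv w (rho : R) k : 0 < rho -> modulus (w - w0) + rho < r ->
  is_derive w 1 (fun w => cint (fun t => F (w + toC rho * gam t) * expc k (toC t)))
    (cint (fun t => f (w + toC rho * gam t) * expc k (toC t))).
Proof.
move=> rho0 wr.
have ws : modulus (w - w0) + modulus (toC rho) < r by rewrite modulus_toC gtr0_norm.
have : is_derive w 1
    (fun h => cint (fun t => F (toC rho * gam t + h * 1) * expc k (toC t)))
    (cint (fun t => f (toC rho * gam t + w * 1) * (1 * expc k (toC t)))).
  apply: (@cint_param R F f (fun t => toC rho * gam t) (fun=> 1)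
    (fun t => expc k (toC t)) w) => [t t01|t t01|||].
  - have [e e0 he] := ball_nbhs (circle_in t ws).
    by exists e => // z; rewrite mulr1 (addrC (toC rho * _)) => ze; apply: dF; exact: he.
  - by rewrite mulr1 (addrC (toC rho * _)); apply: cf; exact: circle_in.
  - exact: (cont01Z (c := toC rho) (@cont01_expc tau)).
  - exact: cont01_cst.
  - exact: cont01_expc.
rewrite (@eq_cint _ _ (fun t => f (w + toC rho * gam t) * expc k (toC t))); last first.
  by move=> t _; rewrite mulr1 mul1r addrC.
congr is_derive; apply/funext => h; apply: eq_cint => t _.
by rewrite mulr1 (addrC (toC rho * _)).
Qed.

End disk.
End circle.

(** * Cauchy's formulas and Cauchy's estimate *)

Section cauchy_formula.
Context {R : realType}.
Local Notation C := (Cplx R).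
Implicit Types (w z : C).

Local Notation tau := (@twopii R).
Local Notation gam := (fun t : R => expc tau (toC t)).

Variables (f : C -> C) (w0 : C) (r : R).
Hypothesis r0 : 0 < r.
Hypothesis df : forall z, modulus (z - w0) < r -> derivable f z 1.

(** Circles of radius r / 2 with centre in the disk of radius r / 2 stay inside the disk of radius
    r. *)
Let rho := r / 2.
Let rho0 : 0 < rho. Proof. by rewrite divr_gt0. Qed.

Let inball w : modulus (w - w0) < rho -> modulus (w - w0) + rho < r.
Proof. by rewrite /rho; lra. Qed.

Let inball0 w : modulus (w - w0) < rho -> modulus (w - w0) < r.
Proof. by move=> /inball; have := rho0; lra. Qed.

Let inballC w : modulus (w - w0) < rho -> modulus (w - w0) + modulus (toC rho) < r.
Proof. by move=> /inball; rewrite modulus_toC gtr0_norm. Qed.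

Let near_ball w : modulus (w - w0) < rho -> \forall v \near w, modulus (v - w0) < rho.
Proof.
move=> wr; apply/nbhs_modulus; exists (rho - modulus (w - w0)); first by rewrite subr_gt0.
by move=> v; rewrite ltrBrDr; apply: le_lt_trans; exact: modulus_tri.
Qed.

Let rhoC0 : toC rho != 0.
Proof. by rewrite toC_eq0 gt_eqF. Qed.

Let cf := holomorphic_ball_continuous df.

(** As [expc (- tau)] inverts the parametrization g of the circle, this is (2 pi i)^-1 times the
    contour integral of f(x) / (x - w)^2 over |x - w| = rho. *)
Definition cauchy_deriv w : C :=
  (toC rho)^-1 * cint (fun t => f (w + toC rho * gam t) * expc (- tau) (toC t)).

Lemma circle_formulas : exists F : C -> C,
  [/\ forall z, modulus (z - w0) < r -> is_derive z 1 F (f z),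
   forall w, modulus (w - w0) < rho ->
     f w = (toC rho)^-1 * cint (fun t => F (w + toC rho * gam t) * expc (- tau) (toC t)) &
   forall w, modulus (w - w0) < rho -> cauchy_deriv w =
     2 * (toC rho)^-1 ^+ 2 *
     cint (fun t => F (w + toC rho * gam t) * expc (- tau - tau) (toC t))].
Proof.
have [F dF] := holomorphic_primitive df.
have tau0 := @twopii_neq0 R.
exists F; split => // w wr.
(* The mean value formula for F holds near w, so it can be differentiated in the centre. *)
- have h1 : is_derive w 1 F (cint (fun t => f (w + toC rho * gam t) * expc 0 (toC t))).
    apply: near_eq_is_derive (circle_deriv dF cf 0 rho0 (inball wr)).
    apply: filterS (near_ball wr) => v vr.
    rewrite (circle_mean dF cf rho0 (inball vr)).
    by apply: eq_cint => t _; rewrite expc0 mulr1.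
  have -> : f w = cint (fun t => f (w + toC rho * gam t) * expc 0 (toC t)).
    by have [_ <-] := dF w (inball0 wr); have [_ <-] := h1.
  (* Integration by parts with k = - tau trades f for F times g^-1; the case k = - 2 tau below
     yields the factor 2 and g^-2. *)
  have := circle_parts dF cf (@cexp_Ntau R) (inballC wr).
  rewrite subrr mulNr => /subr0_eq; rewrite -mulrA => /(mulfI tau0) <-.
  by rewrite mulKf.
- have := circle_parts dF cf (@cexp_N2tau R) (inballC wr).
  rewrite (_ : tau + (- tau - tau) = - tau); last by ring.
  rewrite (_ : - tau - tau = - (tau * 2)); last by ring.
  rewrite mulNr => /subr0_eq; rewrite -!mulrA => /(mulfI tau0) E.
  rewrite /cauchy_deriv -(mulKf rhoC0 (cint _)) E.
  by ring.
Qed.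

Lemma is_derive_cauchy w : modulus (w - w0) < rho -> is_derive w 1 f (cauchy_deriv w).
Proof.
move=> wr; have [F [dF hf _]] := circle_formulas.
apply: near_eq_is_derive (is_deriveZ (toC rho)^-1
  (circle_deriv dF cf (- tau) rho0 (inball wr))).
by apply: filterS (near_ball wr) => v vr; rewrite hf.
Qed.

(** Differentiating under the integral requires a continuous derivative. This is not yet known for
    f', but it is known for f = F', so the expression of f' in terms of F is the one to be
    differentiated. *)
Lemma derivable_derive w : modulus (w - w0) < rho -> derivable (derive1 f) w 1.
Proof.
move=> wr; have [F [dF _ hf]] := circle_formulas.
have [H _] := is_deriveZ (2 * (toC rho)^-1 ^+ 2)
  (circle_deriv dF cf (- tau - tau) rho0 (inball wr)).
apply: near_eq_derivable H.
apply: filterS (near_ball wr) => v vr; rewrite derive1E.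
by have [_ ->] := is_derive_cauchy vr; rewrite hf.
Qed.

(** The bound is 2 M / rho with rho = r / 2, the 2 being that of [cint_le]; it is uniform for w in
    the half disk. *)
Lemma cauchy_estimate w (M : R) : modulus (w - w0) < rho ->
  (forall z, modulus (z - w0) < r -> modulus (f z) <= M) ->
  modulus (derive1 f w) <= 4 * M / r.
Proof.
move=> wr fM; rewrite derive1E; have [_ ->] := is_derive_cauchy wr.
rewrite /cauchy_deriv modulusM modulusV modulus_toC gtr0_norm//.
have cc := cont01M (cont01_circle cf (inballC wr)) (@cont01_expc R (- tau)).
have : modulus (cint (fun t => f (w + toC rho * gam t) * expc (- tau) (toC t))) <= 2 * M.
  apply: (cint_le cc) => t _; rewrite modulusM modulus_expc ?mulr1 ?cplxE ?oppr0//.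
  by apply: fM; apply: circle_in; exact: inballC.
rewrite -(@ler_pM2l _ rho^-1) ?invr_gt0// => /le_trans; apply.
by rewrite /rho le_eqVlt; apply/orP; left; apply/eqP; field; rewrite gt_eqF.
Qed.

End cauchy_formula.

(** * The space A_F(Omega) *)

Section holomorphic_on_open.
Context {R : realType}.
Local Notation C := (Cplx R).
Variable Omega : set C.
Hypothesis Omega_open : open Omega.
Implicit Types (f g k : C -> C) (w v c : C).

Lemma open_ball w : Omega w ->
  exists2 r : R, 0 < r & forall v, modulus (v - w) < r -> Omega v.
Proof.
by move=> Ow; apply/nbhs_modulus; move: Omega_open; rewrite openE; apply.
Qed.

Lemma holomorphic_derive1 f : holomorphic Omega f -> holomorphic Omega (derive1 f).
Proof.
move=> hf w /open_ball[r r0 hr].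
apply: (@derivable_derive R f w r r0) => [z /hr/hf//|].
by rewrite subrr modulus0 divr_gt0.
Qed.

Lemma holomorphic_derive1n f n : holomorphic Omega f -> holomorphic Omega (derive1n n f).
Proof.
move=> hf; elim: n => [|n IH]; first exact: hf.
by rewrite derive1nS; exact: (holomorphic_derive1 IH).
Qed.

(** Since Omega is open, equality on Omega is equality near each of its points, so the values of a
    representative outside Omega do not influence the derivatives. *)
Lemma derive1n_congr f g n : (forall w, Omega w -> f w = g w) ->
  forall w, Omega w -> derive1n n f w = derive1n n g w.
Proof.
move=> fg; elim: n => [|n IH]; first exact: fg.
move=> w /[dup] Ow /open_ball[r r0 hr].
rewrite !derive1nS !derive1E; apply: near_eq_derive.
by apply/nbhs_modulus; exists r => // v /hr/IH.
Qed.

(** The single combination f + c g covers differences, with c = -1, as well as the perturbations f +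
    c e^(t w). *)
Lemma holomorphic_lin f g c : holomorphic Omega f -> holomorphic Omega g ->
  holomorphic Omega (fun z => f z + c * g z).
Proof.
move=> hf hg w Ow.
have [d _] := is_deriveD (derivableP (hf w Ow)) (is_deriveZ c (derivableP (hg w Ow))).
exact: d.
Qed.

Lemma holomorphic_congr f g : (forall w, Omega w -> f w = g w) ->
  holomorphic Omega f -> holomorphic Omega g.
Proof.
move=> fg hf w /[dup] Ow /open_ball[r r0 hr].
apply: near_eq_derivable (hf w Ow).
by apply/nbhs_modulus; exists r => // v /hr/fg.
Qed.

Lemma derive1n_lin f g c n : holomorphic Omega f -> holomorphic Omega g ->
  forall w, Omega w ->
  derive1n n (fun z => f z + c * g z) w = derive1n n f w + c * derive1n n g w.
Proof.
move=> hf hg; elim: n => [//|n IH w] /[dup] Ow /open_ball[r r0 hr].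
rewrite !derive1nS !derive1E.
have [_ <-] : is_derive w 1 (derive1n n f + c *: derive1n n g)
    ('D_1 (derive1n n f) w + c *: 'D_1 (derive1n n g) w).
  exact: (is_deriveD (derivableP (@holomorphic_derive1n f n hf w Ow))
    (is_deriveZ c (derivableP (@holomorphic_derive1n g n hg w Ow)))).
apply: near_eq_derive; apply/nbhs_modulus; exists r => // v /hr/IH ->.
by [].
Qed.

Lemma closure_modulus (A : set C) w : closure A w <->
  forall e : R, 0 < e -> exists2 v, A v & modulus (v - w) < e.
Proof.
split=> [h e e0|h B /nbhs_modulus[e e0 eB]].
  have [|v [Av vw]] := h [set v | modulus (v - w) < e]; last by exists v.
  by apply/nbhs_modulus; exists e.
by have [v Av vw] := h e e0; exists v; split => //; exact: eB.
Qed.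

Lemma within_modulus (A : set C) g : {within A, continuous g} <->
  forall w, A w -> forall e : R, 0 < e -> exists2 r : R, 0 < r &
    forall v, A v -> modulus (v - w) < r -> modulus (g v - g w) < e.
Proof.
rewrite subspace_continuousP; split=> h w Aw.
  move=> e e0; have /cvg_modulusP/(_ e e0) := h w Aw.
  rewrite near_withinE => /nbhs_modulus[r r0 hr].
  by exists r => // v Av vw; exact: hr.
apply/cvg_modulusP => e e0; rewrite near_withinE; apply/nbhs_modulus.
by have [r r0 hr] := h w Aw e e0; exists r => // v vw Av; exact: hr.
Qed.

Lemma extension_unique f g k : is_extension Omega f g -> is_extension Omega f k ->
  forall w, closure Omega w -> g w = k w.
Proof.
move=> [/within_modulus cg fg] [/within_modulus ck fk] w cw.
apply/eqP; rewrite -subr_eq0; apply/eqP; apply: modulus0_eq0; apply/eqP.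
rewrite eq_le modulus_ge0 andbT; apply/ler_addgt0Pr => e e0; rewrite add0r.
have e20 : 0 < e / 2 by rewrite divr_gt0.
have [r r0 hr] := cg w cw _ e20; have [s s0 hs] := ck w cw _ e20.
have rs0 : 0 < Num.min r s by rewrite lt_min r0.
have [v Ov] := (closure_modulus Omega w).1 cw _ rs0.
rewrite lt_min => /andP[vr vs].
have cv : closure Omega v by exact: subset_closure.
have H1 := hr v cv vr; have H2 := hs v cv vs.
have E : g v = k v by rewrite fg ?inE// fk ?inE.
have := modulus_tri (g w) (g v) (k w).
rewrite {2}E (modulusC (g w) (g v)); move: H1 H2.
by lra.
Qed.

Lemma extensionP f : (exists g, is_extension Omega f g) ->
  is_extension Omega f (extension Omega f).
Proof. by move=> [g gf]; apply: (xgetPex f); exists g. Qed.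

Lemma is_extension_lin f g k c ef eg : is_extension Omega f ef -> is_extension Omega g eg ->
  (forall w, Omega w -> k w = f w + c * g w) ->
  is_extension Omega k (fun w => ef w + c * eg w).
Proof.
move=> [cf ff] [cg gg] kE; split; last first.
  by move=> w wO; rewrite ff// gg// kE// -inE.
apply/within_modulus => w cw e e0.
have k0 : 0 < modulus c + 1 by rewrite ltr_wpDl ?modulus_ge0.
have e20 : 0 < e / 2 by rewrite divr_gt0.
have [r r0 hr] := (within_modulus _ _).1 cf w cw _ e20.
have [s s0 hs] := (within_modulus _ _).1 cg w cw _ (divr_gt0 e20 k0).
exists (Num.min r s) => [|v cv]; first by rewrite lt_min r0.
rewrite lt_min => /andP[/(hr v cv) H1 /(hs v cv) H2].
rewrite (_ : ef v + c * eg v - (ef w + c * eg w) =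
  (ef v - ef w) + c * (eg v - eg w)); last by ring.
apply: le_lt_trans (modulusD _ _) _; rewrite modulusM.
move: H2; rewrite ltr_pdivlMr// mulrDr mulr1 (mulrC _ (modulus c)).
by have := modulus_ge0 (eg v - eg w); move: H1; lra.
Qed.

Lemma closed_disk (n : R) : closed [set w : C | modulus w <= n].
Proof.
apply: (@closed_comp _ _ (@modulus R) [set x | x <= n]); last exact: closed_le.
by move=> x _; exact: modulus_continuous.
Qed.

(** The disk is closed and contained in the image of a compact square under (x, y) |-> x + i y. *)
Lemma compact_disk (n : R) : compact [set w : C | modulus w <= n].
Proof.
pose box : set (R * R) := `[- n, n]%classic `*` `[- n, n]%classic.
have cbox : compact box by apply: compact_setX; exact: segment_compact.
pose j (x : R * R) : C := (x.1 +i* x.2)%C.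
have cj : continuous j.
  move=> x; apply/cvg_modulusP => e e0.
  have e20 : 0 < e / 2 by rewrite divr_gt0.
  have n1 : \forall y \near x, `|x.1 - y.1| < e / 2.
    by have /cvgrPdist_lt/(_ _ e20) : fst y @[y --> x] --> x.1 by exact: cvg_fst.
  have n2 : \forall y \near x, `|x.2 - y.2| < e / 2.
    by have /cvgrPdist_lt/(_ _ e20) : snd y @[y --> x] --> x.2 by exact: cvg_snd.
  apply: filterS2 n1 n2 => y h1 h2.
  apply: le_lt_trans (modulus_le _) _; rewrite !cplxE /= distrC (distrC y.2).
  by move: h1 h2; lra.
apply: (@subclosed_compact _ _ (j @` box)).
- exact: closed_disk.
- by apply: continuous_compact => //; exact: continuous_subspaceT.
move=> w /= wn; exists (cRe w, cIm w); last by apply: cplxP.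
split; rewrite /= in_itv/= -ler_norml.
  exact: le_trans (cRe_le w) wn.
exact: le_trans (cIm_le w) wn.
Qed.

(** This makes the set in [sup_seminorm] bounded above, so that [sup] is a genuine supremum. *)
Lemma extension_bounded g (n : R) : {within closure Omega, continuous g} ->
  exists M : R, forall w, closure Omega w -> modulus w <= n -> modulus (g w) <= M.
Proof.
move=> cg.
pose K := closure Omega `&` [set w : C | modulus w <= n].
have cK : compact K.
  apply: (@subclosed_compact _ _ [set w : C | modulus w <= n]).
  - by apply: closedI; [exact: closed_closure|exact: closed_disk].
  - exact: compact_disk.
  - by move=> w [].
have [[w Kw]|K0] := pselect (K !=set0); last first.
  by exists 0 => w cw wn; exfalso; apply: K0; exists w.
have cgK : {within K, continuous (fun w => modulus (g w))}.
  apply/subspace_continuousP => v [cv _]; apply/cvgrPdist_lt => e e0.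
  rewrite near_withinE; apply/nbhs_modulus.
  have [r r0 hr] := (within_modulus _ _).1 cg v cv e e0.
  exists r => // u uv [cu _]; apply: le_lt_trans (hr u cu uv).
  by rewrite ler_norml lerNl opprB {2}modulusC !modulusBl.
have [|c _ hc] := @compact_EVT_max _ _ _ K _ cK cgK; first by exists w.
by exists (modulus (g c)) => v cv vn; apply: hc; rewrite inE.
Qed.

End holomorphic_on_open.

(** * The natural seminorms *)

Section seminorms.
Context {R : realType}.
Local Notation C := (Cplx R).
Variables (Omega : set C) (F I : set nat) (z : nat -> C).
Hypothesis Omega_open : open Omega.
Hypothesis z_in : forall i, I i -> Omega (z i).
Implicit Types (f g k : C -> C) (w v c : C).

Lemma sup_seminorm_ge l n k g w : is_extension Omega (derive1n l k) g ->
  closure Omega w -> modulus w <= n%:R -> modulus (g w) <= sup_seminorm Omega l n k.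
Proof.
move=> kg cw wn; have ext := extensionP (ex_intro _ g kg).
rewrite (extension_unique kg ext cw); apply: ub_le_sup; last by exists w.
have [M hM] := extension_bounded n%:R ext.1.
by exists M => _ [v [cv vn] <-]; exact: hM.
Qed.

(** The condition [0 <= M] is for the case where no point of the closure has modulus at most n,
    since the supremum is then 0. *)
Lemma sup_seminorm_le l n k g (M : R) : is_extension Omega (derive1n l k) g -> 0 <= M ->
  (forall w, closure Omega w -> modulus w <= n%:R -> modulus (g w) <= M) ->
  sup_seminorm Omega l n k <= M.
Proof.
move=> kg M0 gM; have ext := extensionP (ex_intro _ g kg).
rewrite /sup_seminorm; set A := (X in sup X).
have [A0|A0] := pselect (A !=set0); last first.
  by rewrite (_ : A = set0) ?sup0//; apply/eqP/negPn/negP => /set0P.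
apply: ge_sup => // _ [w [cw wn] <-].
by rewrite -(extension_unique kg ext cw); exact: gM.
Qed.

Lemma sup_seminorm_ge0 l n k g : is_extension Omega (derive1n l k) g ->
  0 <= sup_seminorm Omega l n k.
Proof.
move=> kg; have ext := extensionP (ex_intro _ g kg).
rewrite /sup_seminorm; set A := (X in sup X).
have [[_ [w [cw wn] _]]|A0] := pselect (A !=set0); last first.
  by rewrite (_ : A = set0) ?sup0//; apply/eqP/negPn/negP => /set0P.
apply: le_trans (sup_seminorm_ge kg cw wn).
exact: modulus_ge0.
Qed.

Lemma derive1n_lin_congr f g k c l : holomorphic Omega f -> holomorphic Omega g ->
  (forall w, Omega w -> k w = f w + c * g w) ->
  forall w, Omega w -> derive1n l k w = derive1n l f w + c * derive1n l g w.
Proof.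
move=> hf hg kE w Ow.
by rewrite (derive1n_congr Omega_open l kE Ow) (derive1n_lin Omega_open c l hf hg Ow).
Qed.

Lemma is_A_F_lin f g k c : is_A_F Omega F f -> is_A_F Omega F g ->
  (forall w, Omega w -> k w = f w + c * g w) -> is_A_F Omega F k.
Proof.
move=> [hf Af] [hg Ag] kE.
have hk : holomorphic Omega k.
  apply: (holomorphic_congr Omega_open _ (@holomorphic_lin R Omega f g c hf hg)) => w Ow.
  by rewrite kE.
split; first exact: hk.
move=> l Fl; split; first exact: (@holomorphic_derive1n R Omega Omega_open k l hk).
have [_ [ef fef]] := Af l Fl; have [_ [eg geg]] := Ag l Fl.
exists (fun w => ef w + c * eg w); apply: (is_extension_lin fef geg).
exact: derive1n_lin_congr.
Qed.

(** Subadditivity and homogeneity in one inequality. Equality of k with f + c g is asked on Omega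
    only, which suits functions cut off outside Omega. *)
Lemma natural_seminorm_lin p f g k c : natural_seminorms Omega F I z p ->
  is_A_F Omega F f -> is_A_F Omega F g ->
  (forall w, Omega w -> k w = f w + c * g w) -> p k <= p f + modulus c * p g.
Proof.
move=> pn [hf Af] [hg Ag] kE.
have dk l w : Omega w -> derive1n l k w = derive1n l f w + c * derive1n l g w.
  exact: derive1n_lin_congr.
case: pn => [[l [n [Fl _ ->]]]|[l [i [_ Ii ->]]]]; last first.
  rewrite /point_seminorm dk; last exact: z_in.
  by rewrite -modulusM; exact: modulusD.
have [_ [ef fef]] := Af l Fl; have [_ [eg geg]] := Ag l Fl.
apply: (sup_seminorm_le (is_extension_lin fef geg (dk l))).
  apply: addr_ge0; first exact: (sup_seminorm_ge0 _ fef).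
  apply: mulr_ge0; first exact: modulus_ge0.
  exact: (sup_seminorm_ge0 _ geg).
move=> w cw wn; apply: le_trans (modulusD _ _) _; rewrite modulusM.
apply: lerD; first exact: (sup_seminorm_ge fef cw wn).
apply: ler_wpM2l; first exact: modulus_ge0.
exact: (sup_seminorm_ge geg cw wn).
Qed.

Lemma natural_seminorm_ge0 p f : natural_seminorms Omega F I z p ->
  is_A_F Omega F f -> 0 <= p f.
Proof.
move=> [[l [n [Fl _ ->]]]|[l [i [_ Ii ->]]]] [hf Af]; last exact: modulus_ge0.
by have [_ [ef fef]] := Af l Fl; exact: (sup_seminorm_ge0 _ fef).
Qed.

Lemma natural_seminorm_self p f : natural_seminorms Omega F I z p ->
  is_A_F Omega F f -> p (f \- f) = 0.
Proof.
move=> pn Af; apply/eqP; rewrite eq_le (natural_seminorm_ge0 pn) ?andbT; last first.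
  by apply: (is_A_F_lin (c := -1) Af Af) => w _; rewrite mulN1r.
case: Af => hf Af.
have dk l w : Omega w -> derive1n l (f \- f) w = derive1n l f w + -1 * derive1n l f w.
  by apply: derive1n_lin_congr => // v _; rewrite mulN1r.
case: pn => [[l [n [Fl _ ->]]]|[l [i [_ Ii ->]]]]; last first.
  rewrite /point_seminorm dk; last exact: z_in.
  by rewrite mulN1r subrr modulus0.
have [_ [ef fef]] := Af l Fl.
apply: (sup_seminorm_le (is_extension_lin fef fef (dk l))) => // w _ _.
by rewrite mulN1r subrr modulus0.
Qed.

Lemma is_A_F_expc c : is_A_F Omega F (expc c).
Proof.
have he : holomorphic Omega (expc c).
  by move=> w _; have [] := is_derive_expc c w.
split; first exact: he.
move=> l _; split; first exact: (@holomorphic_derive1n R Omega Omega_open (expc c) l he).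
exists (derive1n l (expc c)); split; last by [].
apply: continuous_subspaceT => w; rewrite derive1n_expc.
apply: (@continuousM _ _ (fun=> c ^+ l)); first exact: cst_continuous.
exact: continuous_expc.
Qed.

Local Notation AF := (A_F Omega F I z).

Lemma A_F_openP (U : set AF) : open U -> forall f : AF, U f ->
  exists s : {fset (set AF)},
   [/\ {subset s <= @seminorm_balls R Omega F I z}, (\bigcap_(B in [set` s]) B) f &
     \bigcap_(B in [set` s]) B `<=` U].
Proof.
move=> [D Dsub <-] f [B DB Bf]; have [s sD sB] := Dsub _ DB.
by exists s; split; rewrite ?sB// => g Bg; exists B.
Qed.

Lemma near_seminorm p (f : AF) (e : R) : natural_seminorms Omega F I z p -> 0 < e ->
  \forall h \near f, p ((h : AF) \- f) < e.
Proof.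
move=> pn e0; apply: open_nbhs_nbhs; split.
  exists [set [set g : AF | p (g \- f) < e]]; last by rewrite bigcup_set1.
  move=> _ ->; apply: (@finI_from1 _ _ _ id).
  by exists p, f, e.
by rewrite /= natural_seminorm_self//; exact: A_F_prop.
Qed.

(** * Local continuity of the evaluations *)

Section evaluation.
Variable f0 : AF.

(** Continuity at f0 of the evaluation h |-> h^(l)(w). *)
Definition close_at l w := forall e : R, 0 < e ->
  \forall h \near f0, modulus (derive1n l (h : AF) w - derive1n l f0 w) < e.

(** The same, uniformly on a disk around w; it is this form that Cauchy's estimate and the mean
    value inequality can use. *)
Definition close_around l w := exists2 r : R, 0 < r &
  (forall v, modulus (v - w) < r -> Omega v) /\
  forall e : R, 0 < e -> \forall h \near f0, forall v, modulus (v - w) < r ->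
    modulus (derive1n l (h : AF) v - derive1n l f0 v) < e.

Lemma close_around_at l w : close_around l w -> close_at l w.
Proof.
move=> [r r0 [_ h]] e e0; apply: filterS (h e e0) => g; apply.
by rewrite subrr modulus0.
Qed.

Let hol (g : AF) : holomorphic Omega g := (A_F_prop g).1.

Let dsub (g : AF) l w : Omega w ->
  derive1n l (g \- f0) w = derive1n l g w - derive1n l f0 w.
Proof.
move=> Ow; rewrite (@derive1n_lin_congr g f0 _ (-1) l)//; first by rewrite mulN1r.
by move=> v _; rewrite mulN1r.
Qed.

Lemma close_around_F l w : F l -> Omega w -> close_around l w.
Proof.
move=> Fl /(open_ball Omega_open)[r r0 hr].
(* Radius at most 1 and n > |w| + 1 place the disk within |v| <= n, where the seminorm of index n
   controls it. *)
exists (Num.min 1 r); first by rewrite lt_min ltr01.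
split=> [v|e e0]; first by rewrite lt_min => /andP[_ /hr].
have [n wn] : exists n : nat, modulus w + 1 < n%:R.
  exists (Num.bound (modulus w + 1)).
  by apply: archi_boundP; rewrite addr_ge0 ?modulus_ge0.
have n0 : (0 < n)%N.
  by rewrite -(ltr_nat R); apply: le_lt_trans wn; rewrite addr_ge0 ?modulus_ge0.
have pn : natural_seminorms Omega F I z (sup_seminorm Omega l n).
  by left; exists l, n.
apply: filterS (near_seminorm f0 pn e0) => g ge v.
rewrite lt_min => /andP[v1 /hr Ov].
have [_ /(_ l Fl)[_ [k gk]]] : is_A_F Omega F (g \- f0).
  apply: (is_A_F_lin (c := -1) (A_F_prop g) (A_F_prop f0)) => u _.
  by rewrite mulN1r.
have gkv := gk.2 v (mem_set Ov).
rewrite -dsub//; apply: le_lt_trans ge; rewrite -gkv.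
apply: (sup_seminorm_ge gk); first exact: subset_closure.
apply: le_trans (ltW wn); rewrite -lerBlDl.
by apply: le_trans (ltW v1); exact: modulusBl.
Qed.

Lemma close_around_S l w : close_around l w -> close_around l.+1 w.
Proof.
move=> [r r0 [hr h]].
have r20 : 0 < r / 2 by rewrite divr_gt0.
have r2r : r / 2 < r by rewrite ltr_pdivrMr// ltr_pMr// ltr1n.
exists (r / 2) => //; split=> [v vr|e e0]; first by apply: hr; exact: lt_trans r2r.
(* Cauchy's estimate turns e r / 8 into 4 (e r / 8) / r = e / 2 on the half disk. *)
have e10 : 0 < e * r / 8 by rewrite divr_gt0// mulr_gt0.
apply: filterS (h _ e10) => g hg v vr.
have Ov : Omega v by apply: hr; exact: lt_trans r2r.
rewrite -dsub// derive1nS.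
have hd : holomorphic Omega (derive1n l (g \- f0)).
  apply: (holomorphic_derive1n Omega_open).
  apply: (holomorphic_congr Omega_open _
    (@holomorphic_lin R Omega g f0 (-1) (@hol g) (@hol f0))) => u _.
  by rewrite mulN1r.
apply: (@le_lt_trans _ _ (4 * (e * r / 8) / r)).
  apply: (cauchy_estimate r0) vr _ => [u /hr/hd//|u ur].
  by rewrite dsub; [exact/ltW/hg|exact: hr].
rewrite (_ : _ / r = e / 2); last by field; rewrite gt_eqF.
by rewrite ltr_pdivrMr// ltr_pMr// ltr1n.
Qed.

(** From order l + 1 down to l: control of the derivative on a disk spreads closeness from any one
    of its points v to all of it. The radius is chosen before v, as the connectedness argument
    requires. *)
Lemma close_around_le l w : close_around l.+1 w -> exists2 r : R, 0 < r &
  (forall v, modulus (v - w) < r -> Omega v) /\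
  forall v, modulus (v - w) < r -> close_at l v ->
    forall e : R, 0 < e -> \forall h \near f0, forall u, modulus (u - w) < r ->
      modulus (derive1n l (h : AF) u - derive1n l f0 u) < e.
Proof.
move=> [r r0 [hr h]]; exists r => //; split=> // v vr cv e e0.
have e20 : 0 < e / 2 by rewrite divr_gt0.
(* Two points of the disk are at most 2 r apart, so the values vary by at most 2 (e / (8 r)) (2 r) =
   e / 2. *)
have e10 : 0 < e / (8 * r) by rewrite divr_gt0// mulr_gt0.
apply: filterS2 (cv _ e20) (h _ e10) => g gv hg u ur.
have Ou := hr u ur; have Ov := hr v vr.
move: gv; rewrite -!dsub// => gv.
have hd : holomorphic Omega (derive1n l (g \- f0)).
  apply: (holomorphic_derive1n Omega_open).
  apply: (holomorphic_congr Omega_open _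
    (@holomorphic_lin R Omega g f0 (-1) (@hol g) (@hol f0))) => x _.
  by rewrite mulN1r.
have seg (t : R) : 0 <= t <= 1 -> modulus (v + toC t * (u - v) - w) < r.
  by move=> t01; apply: convex_modulus_lt => //; rewrite (addrC v) subrK.
have mv : modulus (derive1n l (g \- f0) u - derive1n l (g \- f0) v) <=
    2 * (e / (8 * r)) * modulus (u - v).
  apply: (@mean_value R _ (derive1n l.+1 (g \- f0))) => t t01.
    rewrite derive1nS derive1E; apply/derivableP.
    by apply: hd; apply: hr; exact: seg.
  by rewrite dsub; [apply/ltW/hg; exact: seg|apply: hr; exact: seg].
have uv : modulus (u - v) <= 2 * r.
  by have := modulus_tri u w v; rewrite (modulusC w); move: ur vr; lra.
rewrite -[derive1n l _ u](subrK (derive1n l (g \- f0) v)).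
apply: le_lt_trans (modulusD _ _) _.
have : 2 * (e / (8 * r)) * modulus (u - v) <= 2 * (e / (8 * r)) * (2 * r).
  by rewrite ler_wpM2l// mulr_ge0// ltW.
rewrite (_ : 2 * (e / (8 * r)) * (2 * r) = e / 2); last by field; rewrite gt_eqF.
by move: mv gv; lra.
Qed.

End evaluation.
End seminorms.

(** * Continuity of all evaluations, the G_delta property and density *)

Section residual.
Context {R : realType}.
Local Notation C := (Cplx R).
Variables (Omega : set C) (F I : set nat) (z : nat -> C).
Hypothesis Omega_open : open Omega.
Hypothesis z_in : forall i, I i -> Omega (z i).
Local Notation AF := (A_F Omega F I z).

Lemma close_around_component (f0 : AF) l x w :
  (forall v, Omega v -> close_around f0 l.+1 v) -> Omega x -> close_at f0 l x ->
  connected_component Omega x w -> close_around f0 l w.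
Proof.
move=> hS Ox cx xw.
set K := connected_component Omega x in xw.
have KO v : K v -> Omega v by exact: connected_component_sub.
have loc v : Omega v -> exists2 r : R, 0 < r & forall u u', modulus (u - v) < r ->
    modulus (u' - v) < r -> close_at f0 l u -> close_at f0 l u'.
  move=> Ov; have [r r0 [hr h]] := close_around_le Omega_open (hS v Ov).
  exists r => // u u' ur u'r cu e e0.
  by apply: filterS (h u ur cu e e0) => g; exact.
have vv (v : C) (r : R) : 0 < r -> modulus (v - v) < r by rewrite subrr modulus0.
(* The good points of the component form a non-empty set, relatively open and closed because [loc]
   transfers closeness both ways between points of a small disk. *)
have BK : K `&` [set v | close_at f0 l v] = K.
  apply: (@component_connected _ Omega x).
  - by exists x; split => //; exact: connected_component_refl.
  - exists (interior [set v | close_at f0 l v]); first exact: open_interior.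
    apply/seteqP; split=> v [Kv cv]; split => //; last exact: interior_subset cv.
    have [r r0 hr] := loc v (KO v Kv).
    by apply/nbhs_modulus; exists r => // u ur; apply: hr cv => //; exact: vv.
  - exists (~` interior [set v | ~ close_at f0 l v]).
      by apply: open_closedC; exact: open_interior.
    apply/seteqP; split=> v [Kv cv]; split => //.
      by move=> /interior_subset.
    apply: contrapT => ncv; apply: cv.
    have [r r0 hr] := loc v (KO v Kv).
    apply/nbhs_modulus; exists r => // u ur cu; apply: ncv.
    by apply: hr cu => //; exact: vv.
have cw : close_at f0 l w by have : K w := xw; rewrite -BK => -[].
have [r r0 [hr h]] := close_around_le Omega_open (hS w (KO w xw)).
by exists r => //; split=> // e e0; apply: (h w _ cw e e0); exact: vv.
Qed.

Hypothesis F_nonempty : F !=set0.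
Hypothesis z_cover : forall w, Omega w ->
  exists2 i, I i & connected_component Omega (z i) w.

Lemma close_around_all (f0 : AF) l w : Omega w -> close_around f0 l w.
Proof.
have exF : exists n, `[< F n >] by have [n Fn] := F_nonempty; exists n; apply/asboolP.
pose m := ex_minn exF.
have [Fm minm] : F m /\ forall k, F k -> (m <= k)%N.
  rewrite /m; case: ex_minnP => n /asboolP Fn hn; split=> // k Fk.
  by apply: hn; apply/asboolP.
(* Upwards from m = min F by Cauchy's estimates; downwards, by [down], through the components.
   Truncated subtraction makes the steps below order 0 trivial. *)
have up k v : Omega v -> close_around f0 (m + k) v.
  move=> Ov; elim: k => [|k IH]; first by rewrite addn0; exact: close_around_F.
  by rewrite addnS; exact: close_around_S IH.
have down k v : Omega v -> close_around f0 (m - k) v.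
  elim: k v => [|k IH] v Ov; first by have := up 0%N v Ov; rewrite addn0 subn0.
  have [mk|km] := leqP m k.
    have -> : (m - k.+1 = m - k)%N by move: mk; rewrite -subn_eq0 subnS => /eqP ->.
    exact: IH.
  have E : (m - k = (m - k.+1).+1)%N by rewrite -subSn.
  have [i Ii iv] := z_cover Ov.
  apply: (@close_around_component f0 _ (z i)) iv.
  - by move=> u Ou; rewrite -E; exact: IH.
  - exact: z_in.
  - move=> e e0.
    (* The order m - k.+1 is below every element of F, so evaluation at the base point is itself a
       seminorm of the topology. *)
    have pn : natural_seminorms Omega F I z (point_seminorm (m - k.+1) (z i)).
      right; exists (m - k.+1)%N, i; split => // j /minm; apply: leq_trans.
      by rewrite ltn_subrL /= (leq_ltn_trans _ km).
    apply: filterS (near_seminorm Omega_open z_in f0 pn e0) => g.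
    rewrite /point_seminorm (@derive1n_lin_congr _ _ Omega_open g f0 _ (-1)).
    + by rewrite mulN1r.
    + exact: (A_F_prop g).1.
    + exact: (A_F_prop f0).1.
    + by move=> u _; rewrite mulN1r.
    + exact: z_in.
move=> Ow; have [ml|lm] := leqP m l.
  by rewrite -(subnKC ml); exact: up.
by rewrite -(subKn (ltnW lm)); exact: down.
Qed.

Lemma open_large l (M : R) :
  open [set f : AF | exists2 w, Omega w & M < modulus (derive1n l f w)].
Proof.
rewrite openE => f [w Ow Mw]; rewrite /interior.
have e0 : 0 < modulus (derive1n l f w) - M by rewrite subr_gt0.
apply: filterS (close_around_at (close_around_all f l Ow) e0) => g gw.
exists w => //; move: gw; rewrite modulusC => gw.
by have := modulusBl (derive1n l f w) (derive1n l g w); lra.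
Qed.

Lemma unboundedP (A : set C) :
  ~ bounded_set A <-> forall n : nat, exists2 x, A x & n%:R < modulus x.
Proof.
split=> [ub n|h [M [/real_toC[a ->] hM]]].
  apply: contrapT => hn; apply: ub.
  exists (toC n%:R); split; first by apply/complex_realP; exists n%:R.
  move=> x nx y Ay; apply: le_trans (ltW nx).
  rewrite normE toC_le leNgt; apply/negP => ny; apply: hn.
  by exists y.
have [x Ax xa] := h (Num.bound `|a + 1|).
(* [bounded_set] gives a bound only for numbers strictly above [a], hence the passage to [a + 1]. *)
have aa1 : toC a < toC (a + 1) by rewrite toC_lt ltrDl ltr01.
have xa1 : modulus x <= a + 1 by rewrite -toC_le -normE; exact: hM aa1 x Ax.
have := archi_boundP (normr_ge0 (a + 1)).
by have := ler_norm (a + 1); move: xa xa1; lra.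
Qed.

Lemma bounded_modulus (A : set C) : bounded_set A ->
  exists n : nat, forall x, A x -> modulus x <= n%:R.
Proof.
move=> bA; apply: contrapT => hn; have : ~ bounded_set A; last by [].
apply/unboundedP => n; apply: contrapT => hx; apply: hn; exists n => x Ax.
by rewrite leNgt; apply/negP => nx; apply: hx; exists x.
Qed.

Let S := [set f : AF | forall l : nat, ~ bounded_set (derive1n l f @` Omega)].

Lemma Gdelta_unbounded : Gdelta S.
Proof.
(* The pairs (l, n) are enumerated by one natural number; a number that encodes no pair gets the
   whole space. *)
exists (fun k => if (unpickle k : option (nat * nat)) is Some (l, n) then
  [set f : AF | exists2 w, Omega w & n%:R < modulus (derive1n l f w)] else setT).
  move=> k; case: (unpickle k : option (nat * nat)) => [[l n]|]; last exact: openT.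
  exact: open_large.
apply/seteqP; split=> [f Sf k _|f hf l].
  case: (unpickle k : option (nat * nat)) => [[l n]|//].
  have [_ [w Ow <-] nw] := (unboundedP _).1 (Sf l) n.
  by exists w.
apply/unboundedP => n.
have := hf (pickle (l, n)) Logic.I; rewrite pickleK => -[w Ow nw].
by exists (derive1n l f w) => //; exists w.
Qed.

Hypothesis Omega_unbounded : ~ bounded_set Omega.

(** If Re (w t) were bounded above on Omega for each t among 1, -1, i and -i, both parts of w would
    be bounded, hence Omega too. *)
Lemma direction_unbounded : exists2 t : C, t != 0 &
  forall n : nat, exists2 w, Omega w & n%:R < cRe (w * t).
Proof.
apply: contrapT => ht.
have bnd (t : C) : t != 0 -> exists a : R, forall w, Omega w -> cRe (w * t) <= a.
  move=> t0; apply: contrapT => hn; apply: ht; exists t => // n.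
  apply: contrapT => hw; apply: hn; exists n%:R => w Ow.
  by rewrite leNgt; apply/negP => nw; apply: hw; exists w.
pose ii : C := (0 +i* 1)%C.
have ii0 : ii != 0 by apply/eqP => /(congr1 cIm) /= /eqP; rewrite oner_eq0.
have one0 : (1 : C) != 0 by rewrite oner_eq0.
have [a ha] := bnd 1 one0.
have [b hb] : exists a : R, forall w, Omega w -> cRe (w * -1) <= a.
  by apply: bnd; rewrite oppr_eq0.
have [c hc] := bnd ii ii0.
have [d hd] : exists a : R, forall w, Omega w -> cRe (w * - ii) <= a.
  by apply: bnd; rewrite oppr_eq0.
pose n := Num.bound (`|a| + `|b| + (`|c| + `|d|)).
have hn : `|a| + `|b| + (`|c| + `|d|) < n%:R by apply: archi_boundP; rewrite !addr_ge0.
have [w Ow nw] := (unboundedP _).1 Omega_unbounded n.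
have := modulus_le w; have := ler_norm a; have := ler_norm b; have := ler_norm c.
have := ler_norm d; have := ha w Ow; have := hb w Ow; have := hc w Ow; have := hd w Ow.
have e1 : cRe ii = 0 by []. have e2 : cIm ii = 1 by [].
rewrite !cplxE e1 e2 => h1 h2 h3 h4 l1 l2 l3 l4 l5.
have r1 : `|cRe w| <= `|a| + `|b|.
  by rewrite ler_norml; have := normr_ge0 a; have := normr_ge0 b => *; apply/andP; split; lra.
have r2 : `|cIm w| <= `|c| + `|d|.
  by rewrite ler_norml; have := normr_ge0 c; have := normr_ge0 d => *; apply/andP; split; lra.
by lra.
Qed.

Lemma dense_unbounded : dense S.
Proof.
move=> U [f0 Uf0] oU.
have [t t0 tP] := direction_unbounded.
(* The perturbation is set to 0 outside Omega, as the representatives in [A_F] must be. *)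
pose fe_fun (e : R) (w : C) : C := if `[< Omega w >] then f0 w + toC e * expc t w else 0.
have feE e w : Omega w -> fe_fun e w = f0 w + toC e * expc t w.
  by move=> /asboolP Ow; rewrite /fe_fun Ow.
have fe_A e : is_A_F Omega F (fe_fun e).
  apply: (is_A_F_lin Omega_open (A_F_prop f0) (is_A_F_expc F Omega_open t)) => w.
  exact: feE.
have fe_out e w : ~ Omega w -> fe_fun e w = 0.
  by move=> nO; rewrite /fe_fun; case: asboolP.
pose fe e : AF := MkA_F I z (fe_A e) (fe_out e).
have [s [sB sf0 sU]] := A_F_openP oU Uf0.
have near_fe : \forall e \near (0 : R)^'+, (\bigcap_(B in [set` s]) B) (fe e).
  have : (0 : R)^'+ (\bigcap_(B in [set` s]) (fe @^-1` B)).
    apply: filter_bigI => B Bs.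
    have Bf0 := sf0 B Bs.
    have /set_mem[p [f1 [e1 [pn e10 BE]]]] := sB B Bs.
    move: Bf0; rewrite BE /= => pf0.
    have pg : 0 <= p (expc t).
      exact: (natural_seminorm_ge0 pn (is_A_F_expc F Omega_open t)).
    have f01 : is_A_F Omega F (f0 \- f1).
      apply: (is_A_F_lin (c := -1) Omega_open (A_F_prop f0) (A_F_prop f1)) => w _.
      by rewrite mulN1r.
    (* The subbasic ball may be centred at some f1 other than f0; the room left is e1 - p (f0 - f1),
       and the perturbation uses at most e p (e^(t w)) of it. The + 1 avoids a division by 0. *)
    have d0 : 0 < (e1 - p (f0 \- f1)) / (p (expc t) + 1).
      by rewrite divr_gt0 ?subr_gt0// ltr_wpDl.
    have pg1 : 0 < p (expc t) + 1 by rewrite ltr_wpDl.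
    near=> e.
    have e0 : 0 < e by near: e; exact: nbhs_right_gt.
    have ed : e < (e1 - p (f0 \- f1)) / (p (expc t) + 1).
      by near: e; exact: nbhs_right_lt.
    have := @natural_seminorm_lin _ _ _ _ _ Omega_open z_in p (f0 \- f1) (expc t)
      (fe e \- f1) (toC e) pn f01 (is_A_F_expc F Omega_open t).
    rewrite modulus_toC gtr0_norm// => H; apply: le_lt_trans (H _) _.
      by move=> w Ow; rewrite /= feE//; rewrite /GRing.sub_fun addrAC.
    move: ed; rewrite (ltr_pdivlMr _ _ pg1) mulrDr mulr1 => ed.
    by move: e0 ed; lra.
  by apply: filterS => e h B Bs; exact: h.
have [d d0 hd] : exists2 d : R, 0 < d & forall e, 0 < e -> e < d -> U (fe e).
  move: near_fe; rewrite near_withinE => /(nbhs_ballP (0:R) _)[d /= d0 hd].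
  exists d => // e e0 ed; apply: sU; apply: hd => //.
  by rewrite -ball_normE /ball_/= sub0r normrN gtr0_norm.
pose Bad l := [set e : R | bounded_set (derive1n l (fe e) @` Omega)].
have dfe e l w : Omega w ->
    derive1n l (fe e) w = derive1n l f0 w + toC e * (t ^+ l * expc t w).
  move=> Ow.
  rewrite (@derive1n_lin_congr _ _ Omega_open f0 (expc t) _ (toC e))//.
  - by rewrite derive1n_expc.
  - exact: (A_F_prop f0).1.
  - exact: (is_A_F_expc F Omega_open t).1.
  - by move=> v; exact: feE.
have Bad1 l e e' : Bad l e -> Bad l e' -> e = e'.
  move=> /bounded_modulus[n hn] /bounded_modulus[n' hn'].
  apply/eqP; apply: contrapT => /negP ee'.
  (* The l-th derivatives for e and e' differ in modulus by k e^(Re (t w)), which exceeds n + n' at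
     some w because e^x >= 1 + x. *)
  pose k := `|e - e'| * modulus t ^+ l.
  have k0 : 0 < k.
    by rewrite mulr_gt0 ?normr_gt0 ?subr_eq0// exprn_gt0// modulus_gt0.
  have [w Ow hw] := tP (Num.bound ((n%:R + n'%:R) / k)).
  have hb : (n%:R + n'%:R) / k < (Num.bound ((n%:R + n'%:R) / k))%:R.
    by apply: archi_boundP; rewrite divr_ge0 ?addr_ge0// ltW.
  have : modulus (derive1n l (fe e) w - derive1n l (fe e') w) <= n%:R + n'%:R.
    apply: le_trans (modulusB _ _) _; apply: lerD.
      by apply: hn; exists w.
    by apply: hn'; exists w.
  rewrite !dfe// (_ : _ - _ = toC (e - e') * (t ^+ l * expc t w)); last first.
    by rewrite toCD toCN; ring.
  rewrite !modulusM modulus_toC modulusX /expc modulus_cexp mulrA -/k mulrC -ler_pdivlMr//.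
  by have := expR_ge1Dx (cRe (w * t)); move: hw hb; lra.
have cBad : countable (\bigcup_l Bad l).
  apply: bigcup_countable => // l _.
  have [[e Be]|B0] := pselect (Bad l !=set0); last first.
    by rewrite (_ : Bad l = set0) ?countable0//; apply/eqP/negPn/negP => /set0P.
  rewrite (_ : Bad l = [set e]); first exact: countable1.
  by apply/seteqP; split=> [e' /Bad1|_ ->//]; exact.
have [e [/andP[e0 ed] eBad]] : exists e, 0 < e < d /\ ~ (\bigcup_l Bad l) e.
  apply: contrapT => hn.
  (* If every e in ]0, d[ were bad, this interval would be countable and so of measure 0, but its
     length is d > 0. *)
  have cI : countable `]0, d[%classic.
    apply: sub_countable cBad; apply: subset_card_le => e.
    rewrite /= in_itv/= => e0d; apply: contrapT => eB; apply: hn.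
    by exists e.
  have := countable_lebesgue_measure0 cI.
  rewrite lebesgue_measure_itv/= lte_fin d0 sube0 => -[] d00.
  by move: d0; rewrite d00 ltxx.
exists (fe e); split; first exact: hd.
by move=> l hl; apply: eBad; exists l.
Unshelve. all: by end_near. Qed.

End residual.

Theorem proposition7p3 (R : realType) (Omega : set (Cplx R)) (F : set nat)
    (I : set nat) (Omega_ : nat -> set (Cplx R)) (z : nat -> Cplx R)
    (Omega_open : open Omega) (Omega_unbounded : ~ bounded_set Omega)
    (F_nonempty : F !=set0)
    (I_index : finite_set I \/ I = setT)
    (Omega_components : set_bij I (components Omega) Omega_)
    (z_components : forall i, I i -> Omega_ i (z i)) :
  let S := [set f : A_F Omega F I z |
             forall l : nat, ~ bounded_set (derive1n l f @` Omega)] in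
  dense S /\ Gdelta S.
Proof.
have [comp_fun _ comp_surj] := Omega_components.
have z_in i : I i -> Omega (z i).
  move=> Ii; have [w _ wE] := comp_fun i Ii.
  by have := z_components i Ii; rewrite -wE; exact: connected_component_sub.
have z_cover w : Omega w -> exists2 i, I i & connected_component Omega (z i) w.
  move=> Ow; have [i Ii iE] : (Omega_ @` I) (connected_component Omega w).
    by apply: comp_surj; exists w.
  exists i => //; apply: connected_component_sym.
  by rewrite -iE; exact: z_components.
split; first exact: dense_unbounded.
exact: Gdelta_unbounded.
Qed.
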